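(* Let $\mathcal{C}$ be a category with finite products, weak equalisers and finite sums. Then $\mathcal{C}_{ex}$ is a model of CETCS if (i) every object of $\mathcal{C}$ is a choice object, (ii) the terminal object of $\mathcal{C}$ is non-degenerate and indecomposable, (iii) $\mathcal{C}$ is weakly lextensive and closed for pseudo-relations, and (iv) $\mathcal{C}$ has a weak natural numbers object.
   Context: Weak limits are like limits without uniqueness of mediating arrows. Global elements: an arrow $x\colon 1\to X$ is written $x\in X$; for $f\colon X\to Y$ and $y\in Y$, $y\in_f$ means some $x\in X$ has $fx=y$; $f$ is surjective if $y\in_f$ for all $y\in Y$; $Y$ is a choice object if every surjection onto $Y$ has a section. The terminal object is non-degenerate if it is not isomorphic to the initial object, and indecomposable if for every coproduct diagram $i\colon X\to S\leftarrow Y\colon j$ and every $z\in S$ we have $z\in_i$ or $z\in_j$. $\mathcal{C}$ is weakly lextensive if (a) finite sums are disjoint and the initial object is strict, (b) the canonical arrow $(X\times Y)+(X\times Z)\to X\times(Y+Z)$ is an isomorphism, (c) whenever $E_X\to X$ is a weak equaliser of a pair $X\rightrightarrows Z$ and $E_Y\to Y$ is a weak equaliser of a pair $Y\rightrightarrows Z$, then $E_X+E_Y\to X+Y$ is a weak equaliser of the induced pair $X+Y\rightrightarrows Z$. A weak natural numbers object is $N$ with $0\in N$ and $s\colon N\to N$ such that for every $X$, $x\in X$, $f\colon X\to X$ there is (not necessarily unique) $g\colon N\to X$ with $g0=x$ and $gs=fg$. Closed for pseudo-relations: for $g\colon Y\to X$, $f\colon X\to I$, a family of pseudo-relations over $f,g$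 is $h\colon J\to I$, $r\colon R\to J\times X\times Y$ (arbitrary arrows) with (a) $\langle j,x,y\rangle\in_r\Rightarrow gy=x$, (b) $fx=hj\iff\exists y\in Y\,\langle j,x,y\rangle\in_r$, for all elements $j,x,y$. A pseudo-relation over $f,g$ with domain index $i\in I$ is $r\colon R\to X\times Y$ with $\langle x,y\rangle\in_r\Rightarrow gy=x$ and $fx=i\iff\exists y\,\langle x,y\rangle\in_r$. A full family over $f,g$ is a family $\phi\colon F\to I$, $\alpha\colon P\to F\times X\times Y$ over $f,g$ such that for each pseudo-relation $r$ over $f,g$ with domain index $i$ there is $c\in F$ with $\phi c=i$ and $\langle c,x,y\rangle\in_\alpha\Rightarrow\langle x,y\rangle\in_r$ for all $x,y$. $\mathcal{C}$ is closed for pseudo-relations if every composable pair has a full family. Exact completion $\mathcal{C}_{ex}$: objects are pseudo-equivalence relations $r=\langle r_1,r_2\rangle\colon R\to X\times X$ (arrows for which there exist, not necessarily unique, $\rho\colon X\to R$ with $r\rho=\langle1,1\rangle$, $\sigma\colon R\to R$ with $r\sigma=\langle r_2,r_1\rangle$, and $\tau\colon Q\to R$ with $r\tau=\langle r_1p_1,r_2p_2\rangle$ for $(Q,p_1,p_2)$ a weak pullback of $r_2,r_1$); arrows $r\to s$ (with $s\colon S\to Y\times Y$) are classes $[f]$ of $f\colon X\to Y$ admitting $\hat f\colon R\to S$ with $s\hat f=(f\times f)r$, where $f\sim g$ iff some $h\colon X\to S$ has $sh=\langle f,g\rangle$. CETCS: a category $\mathcal{E}$ is a model of CETCS if: (C1)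 it has finite limits and finite colimits; (C2) every composable pair $Y\xrightarrow{g}X\xrightarrow{f}I$ has a universal dependent product, i.e. $\phi\colon F\to I$ and a mono $\alpha\colon P\rightarrowtail F\times X\times Y$ satisfying (a), (b) above and functionality ($\langle j,x,y\rangle\in_\alpha$, $\langle j,x',y'\rangle\in_\alpha$, $x=x'$ imply $y=y'$), such that for every mono $r\colon R\rightarrowtail X\times Y$ that is a pseudo-relation over $f,g$ with domain index $i$ and is functional, there is a unique $c\in F$ with $\phi c=i$ and $\langle c,x,y\rangle\in_\alpha\iff\langle x,y\rangle\in_r$ for all $x,y$; (C3) there is a natural numbers object; (C4) the terminal object is a strong generator (every $f\colon X\to Y$ such that each $y\in Y$ equals $fx$ for a unique $x\in X$ is iso) and separating ($fx=gx$ for all $x\in X$ implies $f=g$); (C5) every object is the codomain of a surjection from a choice object; (C6) the initial object has no global elements; (C7) the terminal object is indecomposable; (C8) in any coproduct diagram $i\colon1\to S\leftarrow1\colon j$, $i\neq j$; (C9) every arrow factors as a surjection followed by a mono; (C10) every equivalence relation is a kernel pair. *)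

(* Defs.v *)
From Stdlib Require Import List FinFun FunctionalExtensionality PropExtensionality ProofIrrelevance.

Set Implicit Arguments.
Unset Strict Implicit.
Unset Printing Implicit Defensive.

Declare Scope cat_scope.
Delimit Scope cat_scope with cat.
Local Open Scope cat_scope.

(** * Categories, limits and colimits *)

Record category := Category {
  ob :> Type;
  hom : ob -> ob -> Type;
  idn : forall X, hom X X;
  comp : forall X Y Z, hom Y Z -> hom X Y -> hom X Z;
  comp_idl : forall X Y (f : hom X Y), comp (idn Y) f = f;
  comp_idr : forall X Y (f : hom X Y), comp f (idn X) = f;
  comp_assoc : forall X Y Z W (h : hom Z W) (g : hom Y Z) (f : hom X Y),
    comp h (comp g f) = comp (comp h g) f }.

Arguments hom {c} X Y.
Arguments idn {c X}.
Arguments comp {c X Y Z} g f.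

Notation "g ∘ f" := (comp g f) (at level 40, left associativity) : cat_scope.

Definition is_mono (C : category) (X Y : C) (f : hom X Y) : Prop :=
  forall (Z : C) (u v : hom Z X), f ∘ u = f ∘ v -> u = v.

Definition is_iso (C : category) (X Y : C) (f : hom X Y) : Prop :=
  exists g : hom Y X, g ∘ f = idn /\ f ∘ g = idn.

Definition isomorphic (C : category) (X Y : C) : Prop :=
  exists f : hom X Y, is_iso f.

Definition is_initial (C : category) (O : C) : Prop :=
  forall X : C, exists! f : hom O X, True.

Definition is_coproduct (C : category) (X Y S : C) (i : hom X S) (j : hom Y S) : Prop :=
  forall (Z : C) (f : hom X Z) (g : hom Y Z),
    exists! h : hom S Z, h ∘ i = f /\ h ∘ j = g.

Definition is_pullback (C : category) (X Y Z Q : C) (f : hom X Z) (g : hom Y Z)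
    (p : hom Q X) (q : hom Q Y) : Prop :=
  f ∘ p = g ∘ q /\
  forall (W : C) (u : hom W X) (v : hom W Y), f ∘ u = g ∘ v ->
    exists! h : hom W Q, p ∘ h = u /\ q ∘ h = v.

Definition is_weak_pullback (C : category) (X Y Z Q : C) (f : hom X Z) (g : hom Y Z)
    (p : hom Q X) (q : hom Q Y) : Prop :=
  f ∘ p = g ∘ q /\
  forall (W : C) (u : hom W X) (v : hom W Y), f ∘ u = g ∘ v ->
    exists h : hom W Q, p ∘ h = u /\ q ∘ h = v.

Definition is_weak_equaliser (C : category) (E X Y : C) (f g : hom X Y) (e : hom E X) : Prop :=
  f ∘ e = g ∘ e /\
  forall (W : C) (u : hom W X), f ∘ u = g ∘ u -> exists h : hom W E, e ∘ h = u.

Definition has_weak_equalisers (C : category) : Prop :=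
  forall (X Y : C) (f g : hom X Y), exists (E : C) (e : hom E X), is_weak_equaliser f g e.

Record functor (J C : category) := Functor {
  fob :> J -> C;
  fhom : forall a b : J, hom a b -> hom (fob a) (fob b);
  fhom_id : forall a : J, fhom (@idn J a) = idn;
  fhom_comp : forall (a b c : J) (v : hom b c) (u : hom a b),
    fhom (v ∘ u) = fhom v ∘ fhom u }.

Definition is_cone (J C : category) (D : functor J C) (L : C) (p : forall a, hom L (D a)) : Prop :=
  forall (a b : J) (u : hom a b), fhom D u ∘ p a = p b.

Definition is_cocone (J C : category) (D : functor J C) (L : C) (i : forall a, hom (D a) L) : Prop :=
  forall (a b : J) (u : hom a b), i b ∘ fhom D u = i a.

Definition is_limit (J C : category) (D : functor J C) (L : C) (p : forall a, hom L (D a)) : Prop :=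
  is_cone p /\
  forall (Z : C) (q : forall a, hom Z (D a)), is_cone q ->
    exists! h : hom Z L, forall a, p a ∘ h = q a.

Definition is_colimit (J C : category) (D : functor J C) (L : C) (i : forall a, hom (D a) L) : Prop :=
  is_cocone i /\
  forall (Z : C) (q : forall a, hom (D a) Z), is_cocone q ->
    exists! h : hom L Z, forall a, h ∘ i a = q a.

Definition finite_category (J : category) : Prop :=
  Finite J /\ forall a b : J, Finite (hom a b).

Definition has_finite_limits (C : category) : Prop :=
  forall (J : category) (D : functor J C), finite_category J ->
    exists (L : C) (p : forall a, hom L (D a)), is_limit p.

Definition has_finite_colimits (C : category) : Prop :=
  forall (J : category) (D : functor J C), finite_category J ->
    exists (L : C) (i : forall a, hom (D a) L), is_colimit i.

Class finprod (C : category) := FinProd {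
  one : C;
  bang : forall X : C, hom X one;
  bang_uniq : forall (X : C) (f : hom X one), f = bang X;
  prod : C -> C -> C;
  pr1 : forall X Y : C, hom (prod X Y) X;
  pr2 : forall X Y : C, hom (prod X Y) Y;
  pair : forall Z X Y : C, hom Z X -> hom Z Y -> hom Z (prod X Y);
  pr1_pair : forall (Z X Y : C) (f : hom Z X) (g : hom Z Y), pr1 X Y ∘ pair f g = f;
  pr2_pair : forall (Z X Y : C) (f : hom Z X) (g : hom Z Y), pr2 X Y ∘ pair f g = g;
  pair_uniq : forall (Z X Y : C) (h : hom Z (prod X Y)), h = pair (pr1 X Y ∘ h) (pr2 X Y ∘ h) }.

Arguments pr1 {C _ X Y}.
Arguments pr2 {C _ X Y}.

Notation "X × Y" := (prod X Y) (at level 40, left associativity) : cat_scope.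
Notation "⟨ f , g ⟩" := (pair f g) (at level 0, f at level 200, g at level 200) : cat_scope.
Notation "⟨ f , g , h ⟩" := (pair (pair f g) h)
  (at level 0, f at level 200, g at level 200, h at level 200) : cat_scope.

Definition prod_map (C : category) (P : finprod C) (X X' Y Y' : C)
  (f : hom X X') (g : hom Y Y') : hom (X × Y) (X' × Y') := ⟨f ∘ pr1, g ∘ pr2⟩.

Class finsum (C : category) := FinSum {
  zero : C;
  absurd : forall X : C, hom zero X;
  absurd_uniq : forall (X : C) (f : hom zero X), f = absurd X;
  sum : C -> C -> C;
  inl : forall X Y : C, hom X (sum X Y);
  inr : forall X Y : C, hom Y (sum X Y);
  copair : forall X Y Z : C, hom X Z -> hom Y Z -> hom (sum X Y) Z;
  copair_inl : forall (X Y Z : C) (f : hom X Z) (g : hom Y Z), copair f g ∘ inl X Y = f;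
  copair_inr : forall (X Y Z : C) (f : hom X Z) (g : hom Y Z), copair f g ∘ inr X Y = g;
  copair_uniq : forall (X Y Z : C) (h : hom (sum X Y) Z), h = copair (h ∘ inl X Y) (h ∘ inr X Y) }.

Arguments inl {C _ X Y}.
Arguments inr {C _ X Y}.

Notation "X ⊕ Y" := (sum X Y) (at level 50, left associativity) : cat_scope.

Definition sum_map (C : category) (S : finsum C) (X X' Y Y' : C)
  (f : hom X X') (g : hom Y Y') : hom (X ⊕ Y) (X' ⊕ Y') := copair (inl ∘ f) (inr ∘ g).

(** * Global elements *)

Section Elements.
Context (C : category) (P : finprod C).

Definition el (X : C) : Type := hom one X.

Definition mem (X Y : C) (f : hom X Y) (y : el Y) : Prop := exists x : el X, f ∘ x = y.

Definition surjective (X Y : C) (f : hom X Y) : Prop := forall y : el Y, mem f y.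

Definition choice_object (Y : C) : Prop :=
  forall (X : C) (f : hom X Y), surjective f -> exists s : hom Y X, f ∘ s = idn.

Definition terminal_nondegenerate : Prop :=
  forall O : C, is_initial O -> ~ isomorphic one O.

Definition terminal_indecomposable : Prop :=
  forall (X Y S : C) (i : hom X S) (j : hom Y S), is_coproduct i j ->
    forall z : el S, mem i z \/ mem j z.

Definition has_weak_nno : Prop :=
  exists (N : C) (z : el N) (s : hom N N),
    forall (X : C) (x : el X) (f : hom X X),
      exists g : hom N X, g ∘ z = x /\ g ∘ s = f ∘ g.

Definition has_nno : Prop :=
  exists (N : C) (z : el N) (s : hom N N),
    forall (X : C) (x : el X) (f : hom X X),
      exists! g : hom N X, g ∘ z = x /\ g ∘ s = f ∘ g.

End Elements.

Notation "y '∈[' f ']'" := (mem f y) (at level 70, f at level 200) : cat_scope.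

(** * Weak lextensivity *)

Section WeaklyLextensive.
Context (C : category) (P : finprod C) (S : finsum C).

Definition sums_disjoint : Prop :=
  forall X Y : C,
    is_mono (inl : hom X (X ⊕ Y)) /\ is_mono (inr : hom Y (X ⊕ Y)) /\
    is_pullback (inl : hom X (X ⊕ Y)) (inr : hom Y (X ⊕ Y)) (absurd X) (absurd Y).

Definition initial_strict : Prop := forall (X : C) (f : hom X zero), is_iso f.

Definition distr (X Y Z : C) : hom ((X × Y) ⊕ (X × Z)) (X × (Y ⊕ Z)) :=
  copair (prod_map P idn inl) (prod_map P idn inr).

Definition weakly_lextensive : Prop :=
  (sums_disjoint /\ initial_strict) /\
  (forall X Y Z : C, is_iso (distr X Y Z)) /\
  (forall (X Y Z EX EY : C) (f f' : hom X Z) (g g' : hom Y Z) (e : hom EX X) (e' : hom EY Y),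
     is_weak_equaliser f f' e -> is_weak_equaliser g g' e' ->
     is_weak_equaliser (copair f g) (copair f' g') (sum_map S e e')).

End WeaklyLextensive.

(** * Pseudo-relations and dependent products *)

Section PseudoRelations.
Context (C : category) (P : finprod C) (Y X I : C) (g : hom Y X) (f : hom X I).

Definition is_family (J R : C) (h : hom J I) (r : hom R (J × X × Y)) : Prop :=
  (forall (j : el P J) (x : el P X) (y : el P Y), ⟨j, x, y⟩ ∈[r] -> g ∘ y = x) /\
  (forall (j : el P J) (x : el P X), f ∘ x = h ∘ j <-> exists y : el P Y, ⟨j, x, y⟩ ∈[r]).

Definition is_pseudo_relation (R : C) (r : hom R (X × Y)) (i : el P I) : Prop :=
  (forall (x : el P X) (y : el P Y), ⟨x, y⟩ ∈[r] -> g ∘ y = x) /\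
  (forall x : el P X, f ∘ x = i <-> exists y : el P Y, ⟨x, y⟩ ∈[r]).

Definition is_full_family (F Q : C) (phi : hom F I) (alpha : hom Q (F × X × Y)) : Prop :=
  is_family phi alpha /\
  forall (R : C) (r : hom R (X × Y)) (i : el P I), is_pseudo_relation r i ->
    exists c : el P F, phi ∘ c = i /\
      forall (x : el P X) (y : el P Y), ⟨c, x, y⟩ ∈[alpha] -> ⟨x, y⟩ ∈[r].

Definition functional_family (J R : C) (r : hom R (J × X × Y)) : Prop :=
  forall (j : el P J) (x x' : el P X) (y y' : el P Y),
    ⟨j, x, y⟩ ∈[r] -> ⟨j, x', y'⟩ ∈[r] -> x = x' -> y = y'.

Definition functional (R : C) (r : hom R (X × Y)) : Prop :=
  forall (x x' : el P X) (y y' : el P Y),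
    ⟨x, y⟩ ∈[r] -> ⟨x', y'⟩ ∈[r] -> x = x' -> y = y'.

Definition is_universal_dependent_product (F Q : C) (phi : hom F I)
    (alpha : hom Q (F × X × Y)) : Prop :=
  is_mono alpha /\ is_family phi alpha /\ functional_family alpha /\
  forall (R : C) (r : hom R (X × Y)) (i : el P I),
    is_mono r -> is_pseudo_relation r i -> functional r ->
    exists! c : el P F, phi ∘ c = i /\
      forall (x : el P X) (y : el P Y), ⟨c, x, y⟩ ∈[alpha] <-> ⟨x, y⟩ ∈[r].

End PseudoRelations.

Definition closed_for_pseudo_relations (C : category) (P : finprod C) : Prop :=
  forall (Y X I : C) (g : hom Y X) (f : hom X I),
    exists (F Q : C) (phi : hom F I) (alpha : hom Q (F × X × Y)),
      is_full_family g f phi alpha.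

Definition has_universal_dependent_products (C : category) (P : finprod C) : Prop :=
  forall (Y X I : C) (g : hom Y X) (f : hom X I),
    exists (F Q : C) (phi : hom F I) (alpha : hom Q (F × X × Y)),
      is_universal_dependent_product g f phi alpha.

(** * Models of CETCS *)

Section CETCS.
Context (E : category) (P : finprod E).

Definition is_equivalence_relation (X R : E) (r : hom R (X × X)) : Prop :=
  is_mono r /\
  (exists rho : hom X R, r ∘ rho = ⟨idn, idn⟩) /\
  (exists sigma : hom R R, r ∘ sigma = ⟨pr2 ∘ r, pr1 ∘ r⟩) /\
  (exists (Q : E) (p1 p2 : hom Q R),
     is_pullback (pr2 ∘ r) (pr1 ∘ r) p1 p2 /\
     exists tau : hom Q R, r ∘ tau = ⟨pr1 ∘ r ∘ p1, pr2 ∘ r ∘ p2⟩).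

Definition terminal_strong_generator : Prop :=
  forall (X Y : E) (f : hom X Y),
    (forall y : el P Y, exists! x : el P X, f ∘ x = y) -> is_iso f.

Definition terminal_separating : Prop :=
  forall (X Y : E) (f g : hom X Y), (forall x : el P X, f ∘ x = g ∘ x) -> f = g.

Record CETCS : Prop := {
  C1 : has_finite_limits E /\ has_finite_colimits E;
  C2 : has_universal_dependent_products P;
  C3 : has_nno P;
  C4 : terminal_strong_generator /\ terminal_separating;
  C5 : forall Y : E, exists (X : E) (f : hom X Y), choice_object P X /\ surjective P f;
  C6 : forall O : E, is_initial O -> el P O -> False;
  C7 : terminal_indecomposable P;
  C8 : forall (S : E) (i j : hom one S), is_coproduct i j -> i <> j;
  C9 : forall (X Y : E) (f : hom X Y), exists (M : E) (e : hom X M) (m : hom M Y),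
         surjective P e /\ is_mono m /\ f = m ∘ e;
  C10 : forall (X R : E) (r : hom R (X × X)), is_equivalence_relation r ->
          exists (Y : E) (f : hom X Y), is_pullback f f (pr1 ∘ r) (pr2 ∘ r) }.

End CETCS.

(** The axioms other than (C1) mention a terminal object and binary products;
    by (C1) some exist, and the axioms do not depend on which are chosen. *)
Definition is_model_of_CETCS (E : category) : Prop := exists P : finprod E, CETCS P.

(** * Exact completion *)

Section ExactCompletion.
Context (C : category) (P : finprod C).

(** As [Q] is only a weak pullback, asking for [tau] on one weak pullback is the
    same as asking for it on every one, provided that one exists. *)
Definition is_pseudo_equivalence_relation (X R : C) (r : hom R (X × X)) : Prop :=
  (exists rho : hom X R, r ∘ rho = ⟨idn, idn⟩) /\
  (exists sigma : hom R R, r ∘ sigma = ⟨pr2 ∘ r, pr1 ∘ r⟩) /\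
  (exists (Q : C) (p1 p2 : hom Q R),
     is_weak_pullback (pr2 ∘ r) (pr1 ∘ r) p1 p2 /\
     exists tau : hom Q R, r ∘ tau = ⟨pr1 ∘ r ∘ p1, pr2 ∘ r ∘ p2⟩).

Record ex_ob := ExOb {
  ex_carrier : C;
  ex_dom : C;
  ex_rel :> hom ex_dom (ex_carrier × ex_carrier);
  ex_relP : is_pseudo_equivalence_relation ex_rel }.

Definition extensional (r s : ex_ob) (f : hom (ex_carrier r) (ex_carrier s)) : Prop :=
  exists fhat : hom (ex_dom r) (ex_dom s), s ∘ fhat = prod_map P f f ∘ r.

Definition ex_sim (X : C) (s : ex_ob) (f g : hom X (ex_carrier s)) : Prop :=
  exists h : hom X (ex_dom s), s ∘ h = ⟨f, g⟩.

(** An arrow is an actual equivalence class, that is, a predicate on arrows of [C];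
    equality of arrows is then Leibniz equality, by propositional and functional
    extensionality. *)
Definition is_ex_class (r s : ex_ob) (c : hom (ex_carrier r) (ex_carrier s) -> Prop) : Prop :=
  exists f, extensional f /\ forall g, c g <-> extensional g /\ ex_sim f g.

Record ex_hom (r s : ex_ob) := ExHom {
  ex_class :> hom (ex_carrier r) (ex_carrier s) -> Prop;
  ex_classP : is_ex_class ex_class }.

Lemma pair_comp (W Z X Y : C) (f : hom Z X) (g : hom Z Y) (h : hom W Z) :
  ⟨f, g⟩ ∘ h = ⟨f ∘ h, g ∘ h⟩.
Proof.
rewrite (pair_uniq (⟨f, g⟩ ∘ h)), !comp_assoc, pr1_pair, pr2_pair; reflexivity.
Qed.

Lemma prod_map_pair (Z X X' Y Y' : C) (f : hom X X') (g : hom Y Y') (u : hom Z X) (v : hom Z Y) :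
  prod_map P f g ∘ ⟨u, v⟩ = ⟨f ∘ u, g ∘ v⟩.
Proof.
unfold prod_map; rewrite pair_comp, <- !comp_assoc, pr1_pair, pr2_pair; reflexivity.
Qed.

Lemma prod_map_id (X Y : C) : prod_map P (@idn C X) (@idn C Y) = idn.
Proof.
unfold prod_map; rewrite !comp_idl, (pair_uniq idn), !comp_idr; reflexivity.
Qed.

Lemma prod_map_comp (X X' X'' Y Y' Y'' : C) (f' : hom X' X'') (f : hom X X')
    (g' : hom Y' Y'') (g : hom Y Y') :
  prod_map P (f' ∘ f) (g' ∘ g) = prod_map P f' g' ∘ prod_map P f g.
Proof.
unfold prod_map at 3; rewrite prod_map_pair, !comp_assoc; reflexivity.
Qed.

Lemma extensional_id (r : ex_ob) : extensional (r := r) (s := r) idn.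
Proof. exists idn; rewrite prod_map_id, comp_idr, comp_idl; reflexivity. Qed.

Lemma extensional_comp (r s t : ex_ob) (g : hom (ex_carrier s) (ex_carrier t))
    (f : hom (ex_carrier r) (ex_carrier s)) :
  extensional g -> extensional f -> extensional (r := r) (s := t) (g ∘ f).
Proof.
intros [gh Hg] [fh Hf]; exists (gh ∘ fh).
rewrite comp_assoc, Hg, <- comp_assoc, Hf, comp_assoc, prod_map_comp; reflexivity.
Qed.

Lemma ex_sim_refl (X : C) (s : ex_ob) (f : hom X (ex_carrier s)) : ex_sim f f.
Proof.
destruct (ex_relP s) as [[rho Hrho] _]; exists (rho ∘ f).
rewrite comp_assoc, Hrho, pair_comp, comp_idl; reflexivity.
Qed.

Lemma ex_sim_sym (X : C) (s : ex_ob) (f g : hom X (ex_carrier s)) : ex_sim f g -> ex_sim g f.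
Proof.
destruct (ex_relP s) as [_ [[sigma Hsigma] _]]; intros [h Hh]; exists (sigma ∘ h).
rewrite comp_assoc, Hsigma, pair_comp, <- !comp_assoc, Hh, pr1_pair, pr2_pair; reflexivity.
Qed.

Lemma ex_sim_trans (X : C) (s : ex_ob) (f g k : hom X (ex_carrier s)) :
  ex_sim f g -> ex_sim g k -> ex_sim f k.
Proof.
destruct (ex_relP s) as [_ [_ (Q & p1 & p2 & [_ HQ] & tau & Htau)]].
intros [h Hh] [h' Hh'].
destruct (HQ X h h') as (w & <- & <-).
{ rewrite <- !comp_assoc, Hh, Hh', pr2_pair, pr1_pair; reflexivity. }
exists (tau ∘ w).
rewrite comp_assoc, Htau, pair_comp, <- !comp_assoc, Hh, Hh', pr1_pair, pr2_pair; reflexivity.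
Qed.

Lemma ex_sim_precomp (X X' : C) (s : ex_ob) (f g : hom X' (ex_carrier s)) (u : hom X X') :
  ex_sim f g -> ex_sim (f ∘ u) (g ∘ u).
Proof.
intros [h Hh]; exists (h ∘ u); rewrite comp_assoc, Hh, pair_comp; reflexivity.
Qed.

Lemma ex_sim_postcomp (X : C) (s t : ex_ob) (f g : hom X (ex_carrier s))
    (k : hom (ex_carrier s) (ex_carrier t)) :
  extensional k -> ex_sim f g -> ex_sim (s := t) (k ∘ f) (k ∘ g).
Proof.
intros [kh Hk] [h Hh]; exists (kh ∘ h).
rewrite comp_assoc, Hk, <- comp_assoc, Hh, prod_map_pair; reflexivity.
Qed.

Lemma is_ex_class_of (r s : ex_ob) (f : hom (ex_carrier r) (ex_carrier s)) :
  extensional f -> is_ex_class (fun g => extensional g /\ ex_sim f g).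
Proof. intros Hf; exists f; split; [exact Hf | intros g; reflexivity]. Qed.

Definition ex_class_of (r s : ex_ob) (f : hom (ex_carrier r) (ex_carrier s))
  (Hf : extensional f) : ex_hom r s := ExHom (is_ex_class_of Hf).

Definition ex_id (r : ex_ob) : ex_hom r r := ex_class_of (extensional_id r).

Lemma is_ex_class_comp (r s t : ex_ob) (d : ex_hom s t) (c : ex_hom r s) :
  is_ex_class (r := r) (s := t) (fun h =>
    exists g f, d g /\ c f /\ extensional h /\ ex_sim (g ∘ f) h).
Proof.
destruct d as [d [g0 [Hg0 Hd]]], c as [c [f0 [Hf0 Hc]]]; simpl.
exists (g0 ∘ f0); split; [exact (extensional_comp Hg0 Hf0) |].
intros h; split.
- intros (g & f & Hg & Hf & Hh & Hs); split; [exact Hh |].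
  apply Hd in Hg; apply Hc in Hf.
  apply ex_sim_trans with (g := (g0 ∘ f)).
  + apply ex_sim_postcomp with (s := s); tauto.
  + apply ex_sim_trans with (g := (g ∘ f)); [apply ex_sim_precomp |]; tauto.
- intros [Hh Hs]; exists g0, f0; repeat split; auto.
  + apply Hd; split; [exact Hg0 | apply ex_sim_refl].
  + apply Hc; split; [exact Hf0 | apply ex_sim_refl].
Qed.

(** [g] after [f] is the class of [g ∘ f], for any representatives. *)
Definition ex_comp (r s t : ex_ob) (d : ex_hom s t) (c : ex_hom r s) : ex_hom r t :=
  ExHom (is_ex_class_comp d c).

Lemma ex_hom_repr (r s : ex_ob) (c : ex_hom r s) :
  exists (f : hom (ex_carrier r) (ex_carrier s)) (Hf : extensional f), c = ex_class_of Hf.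
Proof.
destruct c as [c Hc]; assert (H := Hc); destruct H as [f [Hf Hcf]].
exists f, Hf; unfold ex_class_of.
assert (E : c = fun g => extensional g /\ ex_sim f g).
{ apply functional_extensionality; intros g; apply propositional_extensionality, Hcf. }
subst c; f_equal; apply proof_irrelevance.
Qed.

Lemma ex_class_of_eq (r s : ex_ob) (f g : hom (ex_carrier r) (ex_carrier s))
    (Hf : extensional f) (Hg : extensional g) :
  ex_class_of Hf = ex_class_of Hg <-> ex_sim f g.
Proof.
split.
- intros E; apply (f_equal (fun c => ex_class c g)) in E; simpl in E.
  assert (H : extensional g /\ ex_sim f g)
    by (rewrite E; split; [exact Hg | apply ex_sim_refl]).
  exact (proj2 H).
- intros Hs; unfold ex_class_of.
  assert (E : (fun k => extensional k /\ ex_sim f k) = fun k => extensional k /\ ex_sim g k).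
  { apply functional_extensionality; intros k; apply propositional_extensionality.
    split; intros [Hk Hk']; (split; [exact Hk |]);
      [apply ex_sim_trans with (g := f); [apply ex_sim_sym |] | apply ex_sim_trans with (g := g)]; assumption. }
  generalize (is_ex_class_of Hf) (is_ex_class_of Hg); rewrite E.
  intros H1 H2; f_equal; apply proof_irrelevance.
Qed.

Lemma ex_comp_class_of (r s t : ex_ob) (g : hom (ex_carrier s) (ex_carrier t))
    (f : hom (ex_carrier r) (ex_carrier s)) (Hg : extensional g) (Hf : extensional f) :
  ex_comp (ex_class_of Hg) (ex_class_of Hf) = ex_class_of (extensional_comp Hg Hf).
Proof.
destruct (ex_hom_repr (ex_comp (ex_class_of Hg) (ex_class_of Hf))) as (k & Hk & E).
rewrite E; apply ex_class_of_eq, ex_sim_sym.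
assert (Hkk : ex_class (ex_class_of Hk) k) by (split; [exact Hk | apply ex_sim_refl]).
rewrite <- E in Hkk; destruct Hkk as (g' & f' & [Hg' Hgg'] & [Hf' Hff'] & _ & Hs).
apply ex_sim_trans with (g := (g ∘ f')); [apply ex_sim_postcomp with (s := s); assumption |].
apply ex_sim_trans with (g := (g' ∘ f')); [apply ex_sim_precomp |]; assumption.
Qed.

Lemma ex_comp_idl (r s : ex_ob) (c : ex_hom r s) : ex_comp (ex_id s) c = c.
Proof.
destruct (ex_hom_repr c) as (f & Hf & ->); unfold ex_id.
rewrite ex_comp_class_of; apply ex_class_of_eq; rewrite comp_idl; apply ex_sim_refl.
Qed.

Lemma ex_comp_idr (r s : ex_ob) (c : ex_hom r s) : ex_comp c (ex_id r) = c.
Proof.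
destruct (ex_hom_repr c) as (f & Hf & ->); unfold ex_id.
rewrite ex_comp_class_of; apply ex_class_of_eq; rewrite comp_idr; apply ex_sim_refl.
Qed.

Lemma ex_comp_assoc (r s t u : ex_ob) (e : ex_hom t u) (d : ex_hom s t) (c : ex_hom r s) :
  ex_comp e (ex_comp d c) = ex_comp (ex_comp e d) c.
Proof.
destruct (ex_hom_repr c) as (f & Hf & ->), (ex_hom_repr d) as (g & Hg & ->),
  (ex_hom_repr e) as (h & Hh & ->).
rewrite !ex_comp_class_of; apply ex_class_of_eq; rewrite comp_assoc; apply ex_sim_refl.
Qed.

Definition exact_completion : category :=
  Category ex_comp_idl ex_comp_idr ex_comp_assoc.

End ExactCompletion.

(* Main.v *)
(** As every object of [C] is a choice object, an arrow [f] factors through [r] as soon as each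
    point [f x] lies in the image of [r] on points.  So [C] is governed by points: call a set of
    points definable if it is the set of values of an arbitrary arrow.  Definable sets are closed
    under regular logic, under universal quantification and implication because of full families,
    and under disjunction because [one] is indecomposable.  Total definable relations contain
    arrows.  Hence the exact completion is the category of sets of points modulo definable
    equivalence relations, whose arrows are exactly the functions with definable graph, and it
    inherits the definability calculus together with unique choice and effective quotients.  The
    axioms are then proved by set-theoretic reasoning on points.  Coequalisers need transitive
    closures, which are obtained from chains indexed by the natural numbers object. *)

From Stdlib Require Import List FinFun ClassicalEpsilon ProofIrrelevance ssreflect.
Require Import Defs.

Set Implicit Arguments.
Unset Strict Implicit.
Unset Printing Implicit Defensive.
Local Open Scope cat_scope.

(** * Calculus of pairs and points *)

Lemma pr1_pair_comp (C : category) (P : finprod C) (W Z X Y : C)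
    (f : hom Z X) (g : hom Z Y) (h : hom W Z) :
  pr1 ∘ (⟨f, g⟩ ∘ h) = f ∘ h.
Proof. by rewrite comp_assoc pr1_pair. Qed.

Lemma pr2_pair_comp (C : category) (P : finprod C) (W Z X Y : C)
    (f : hom Z X) (g : hom Z Y) (h : hom W Z) :
  pr2 ∘ (⟨f, g⟩ ∘ h) = g ∘ h.
Proof. by rewrite comp_assoc pr2_pair. Qed.

Lemma pair_eta (C : category) (P : finprod C) (Z X Y : C) (h : hom Z (X × Y)) :
  ⟨pr1 ∘ h, pr2 ∘ h⟩ = h.
Proof. by rewrite -pair_uniq. Qed.

Lemma pair_inj (C : category) (P : finprod C) (Z X Y : C) (f f' : hom Z X) (g g' : hom Z Y) :
  ⟨f, g⟩ = ⟨f', g'⟩ -> f = f' /\ g = g'.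
Proof.
by move=> E; rewrite -(pr1_pair f g) -{2}(pr2_pair f g) E pr1_pair pr2_pair.
Qed.

Lemma bang_eq (C : category) (P : finprod C) (X : C) (f g : hom X one) : f = g.
Proof. by rewrite (bang_uniq f) (bang_uniq g). Qed.

Lemma point_one (C : category) (P : finprod C) (x : el P one) : x = idn.
Proof. exact: bang_eq. Qed.

(** Nesting composites to the right hides a projection of a pair inside a longer composite;
    [pr1_pair_comp] and [pr2_pair_comp] reach it there. *)
Ltac catsimp := rewrite -?comp_assoc ?pair_comp -?comp_assoc ?pr1_pair ?pr2_pair
  ?pr1_pair_comp ?pr2_pair_comp ?comp_idl ?comp_idr.

Definition injective_on_points (C : category) (P : finprod C) (X Y : C) (f : hom X Y) : Prop :=
  forall x x' : el P X, f ∘ x = f ∘ x' -> x = x'.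

(** * Definable sets of points *)

Section Definability.
Context (C : category) (P : finprod C).

(** Arbitrary arrows, rather than monos, present these sets, so that images and projections are
    obtained by mere composition. *)
Definition definable (X : C) (U : el P X -> Prop) : Prop :=
  exists (R : C) (r : hom R X), forall x, U x <-> x ∈[r].

Definition pointwise (Z X : C) (t : el P Z -> el P X) : Prop :=
  exists f : hom Z X, forall z, t z = f ∘ z.

Definition definable_rel (X Y : C) (V : el P X -> el P Y -> Prop) : Prop :=
  definable (fun z : el P (X × Y) => V (pr1 ∘ z) (pr2 ∘ z)).

(** Weak equalisers enter the calculus through this property, which also holds in the exact
    completion; so one calculus serves both categories. *)
Definition equality_definable : Prop :=
  forall (X Y : C) (f g : hom X Y), definable (fun x => f ∘ x = g ∘ x).

(** Sums are described by their points and without chosen structure, a form that passes to the exact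
    completion. *)
Definition pointwise_sums : Prop :=
  (exists O : C, is_initial O /\ (el P O -> False)) /\
  forall X Y : C, exists (T : C) (i : hom X T) (j : hom Y T), is_coproduct i j /\
    injective_on_points P i /\ injective_on_points P j /\
    (forall (x : el P X) (y : el P Y), i ∘ x <> j ∘ y) /\ (forall z : el P T, z ∈[i] \/ z ∈[j]).

Lemma pointwise_id (X : C) : pointwise (fun x : el P X => x).
Proof. by exists idn => z; rewrite comp_idl. Qed.

Lemma pointwise_const (Z X : C) (x : el P X) : pointwise (fun _ : el P Z => x).
Proof.
by exists (x ∘ bang Z) => z; rewrite -comp_assoc (point_one (bang Z ∘ z)) comp_idr.
Qed.

Lemma pointwise_comp (Z X Y : C) (f : hom X Y) (t : el P Z -> el P X) :
  pointwise t -> pointwise (fun z => f ∘ t z).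
Proof. by move=> [g Hg]; exists (f ∘ g) => z; rewrite Hg comp_assoc. Qed.

Lemma pointwise_pair (Z X Y : C) (t : el P Z -> el P X) (u : el P Z -> el P Y) :
  pointwise t -> pointwise u -> pointwise (fun z => ⟨t z, u z⟩).
Proof. by move=> [f Hf] [g Hg]; exists ⟨f, g⟩ => z; rewrite pair_comp Hf Hg. Qed.

Lemma definable_ext (X : C) (U V : el P X -> Prop) :
  (forall x, U x <-> V x) -> definable U -> definable V.
Proof. by move=> H [R [r Hr]]; exists R, r => x; rewrite -H. Qed.

Lemma definable_mem (X R : C) (r : hom R X) : definable (fun x => x ∈[r]).
Proof. by exists R, r. Qed.

Lemma definable_true (X : C) : definable (fun _ : el P X => True).
Proof. by exists X, idn => x; split=> // _; exists x; rewrite comp_idl. Qed.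

Lemma definable_image (X Y : C) (f : hom X Y) (U : el P X -> Prop) :
  definable U -> definable (fun y => exists x, U x /\ f ∘ x = y).
Proof.
move=> [R [r Hr]]; exists R, (f ∘ r) => y; split.
- by move=> [x [/Hr [a <-] <-]]; exists a; rewrite comp_assoc.
- move=> [a <-]; exists (r ∘ a); rewrite comp_assoc; split=> //.
  by apply/Hr; exists a.
Qed.

Context (Heq : equality_definable).

(** The pairs of [x] and [a] with [f x = r a] are definable by [Heq], and they project onto the
    preimage. *)
Lemma definable_preimage (X Y : C) (U : el P Y -> Prop) (t : el P X -> el P Y) :
  definable U -> pointwise t -> definable (fun x => U (t x)).
Proof.
move=> [R [r Hr]] [f Hf].
apply: definable_ext (definable_image pr1 (Heq (f ∘ pr1) (r ∘ pr2 : hom (X × R) Y))) => x.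
rewrite Hf; split.
- by move=> [z [E <-]]; apply/Hr; exists (pr2 ∘ z); rewrite !comp_assoc -E.
- by move=> /Hr [a Ha]; exists ⟨x, a⟩; catsimp.
Qed.

Lemma definable_rel_preimage (Z X Y : C) (V : el P X -> el P Y -> Prop)
    (t : el P Z -> el P X) (u : el P Z -> el P Y) :
  definable_rel V -> pointwise t -> pointwise u -> definable (fun z => V (t z) (u z)).
Proof.
move=> HV Ht Hu.
apply: definable_ext (definable_preimage HV (pointwise_pair Ht Hu)) => z.
by rewrite pr1_pair pr2_pair.
Qed.

Lemma definable_and (X : C) (U V : el P X -> Prop) :
  definable U -> definable V -> definable (fun x => U x /\ V x).
Proof.
move=> [R [r Hr]] HV.
have HV' : definable (fun a : el P R => V (r ∘ a)).
{ by apply: definable_preimage => //; apply: pointwise_comp; apply: pointwise_id. }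
apply: definable_ext (definable_image r HV') => x; split.
- by move=> [a [Ha <-]]; split=> //; apply/Hr; exists a.
- by move=> [/Hr [a <-] Ha]; exists a.
Qed.

Lemma definable_eq (Z X : C) (t u : el P Z -> el P X) :
  pointwise t -> pointwise u -> definable (fun z => t z = u z).
Proof.
move=> [f Hf] [g Hg].
by apply: definable_ext (Heq f g) => z; rewrite Hf Hg.
Qed.

Lemma definable_ex (Z Y : C) (V : el P Z -> el P Y -> Prop) :
  definable_rel V -> definable (fun z => exists y, V z y).
Proof.
move=> HV; apply: definable_ext (definable_image pr1 HV) => z; split.
- by move=> [w [Hw <-]]; exists (pr2 ∘ w).
- by move=> [y Hy]; exists ⟨z, y⟩; catsimp.
Qed.

(** For [u] presenting [U], the index arrow [phi] of a full family over [u] and [f] presents the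
    required set. If the fibre over [i] lies in [U], all pairs with [u y = x] and [f x = i] form a
    pseudo-relation, so fullness gives an index over [i]; conversely, an index over [i] supplies a
    preimage under [u] for each [x] in the fibre. *)
Lemma definable_all_fiber (Hcl : closed_for_pseudo_relations P) (X I : C) (f : hom X I)
    (U : el P X -> Prop) :
  definable U -> definable (fun i => forall x, f ∘ x = i -> U x).
Proof.
move=> [Y [u Hu]].
have [F [Q [phi [alpha [[Ha Hb] Hfull]]]]] := Hcl Y X I u f.
exists F, phi => i; split.
- move=> Hi.
  have [R [r Hr]] : definable (fun z : el P (X × Y) => u ∘ (pr2 ∘ z) = pr1 ∘ z /\ f ∘ (pr1 ∘ z) = i).
  { by apply: definable_and; apply: definable_eq;
      repeat (apply: pointwise_const || apply: pointwise_comp || apply: pointwise_id). }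
  case: (Hfull R r i); last by move=> c [Hc _]; exists c.
  split.
  + by move=> x y /Hr; catsimp; case.
  + move=> x; split.
    * move=> Hx; have /Hu [y Hy] := Hi x Hx; exists y.
      by apply/Hr; catsimp.
    * by move=> [y /Hr]; catsimp; case.
- move=> [c <-] x /Hb [y /Ha <-]; apply/Hu; by exists y.
Qed.

Lemma definable_all (Hcl : closed_for_pseudo_relations P) (Z Y : C)
    (V : el P Z -> el P Y -> Prop) :
  definable_rel V -> definable (fun z => forall y, V z y).
Proof.
move=> HV; apply: definable_ext (definable_all_fiber Hcl pr1 HV) => z; split.
- by move=> H y; move: (H ⟨z, y⟩); catsimp; apply.
- by move=> H w E; rewrite E; apply: H.
Qed.

(** For [r] presenting [U], the implication at [x] says that the fibre of [r] over [x] lies in the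
    preimage of [V]. *)
Lemma definable_imp (Hcl : closed_for_pseudo_relations P) (X : C) (U V : el P X -> Prop) :
  definable U -> definable V -> definable (fun x => U x -> V x).
Proof.
move=> [R [r Hr]] HV.
have HV' : definable (fun a : el P R => V (r ∘ a)).
{ by apply: definable_preimage => //; apply: pointwise_comp; apply: pointwise_id. }
apply: definable_ext (definable_all_fiber Hcl r HV') => x; split.
- by move=> H /Hr [a Ha]; rewrite -Ha; apply: H.
- by move=> H a Ha; rewrite Ha; apply: H; apply/Hr; exists a.
Qed.

Lemma definable_false (Hs : pointwise_sums) (X : C) : definable (fun _ : el P X => False).
Proof.
have [[O [HO HO']] _] := Hs; have [f _] := HO X.
by exists O, f => x; split=> // [[o _]]; apply: HO'.
Qed.

Lemma definable_or (Hs : pointwise_sums) (X : C) (U V : el P X -> Prop) :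
  definable U -> definable V -> definable (fun x => U x \/ V x).
Proof.
move=> [R [r Hr]] [R' [r' Hr']].
have [T [i [j [Hij [_ [_ [_ HT]]]]]]] := proj2 Hs R R'.
have [h [[Hi Hj] _]] := Hij X r r'.
exists T, h => x; split.
- case=> [/Hr [a <-]|/Hr' [a <-]].
  + by exists (i ∘ a); rewrite comp_assoc Hi.
  + by exists (j ∘ a); rewrite comp_assoc Hj.
- move=> [z <-]; case: (HT z) => [[a <-]|[a <-]].
  + by left; apply/Hr; exists a; rewrite comp_assoc Hi.
  + by right; apply/Hr'; exists a; rewrite comp_assoc Hj.
Qed.

End Definability.

Ltac pointwise_tac := cbv beta;
  match goal with
  | |- pointwise (fun z => z) => apply: pointwise_id
  | |- pointwise (fun z => comp ?f (@?t z)) =>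
      apply: (@pointwise_comp _ _ _ _ _ f t); pointwise_tac
  | |- pointwise (fun z => pair (@?t z) (@?u z)) =>
      apply: (@pointwise_pair _ _ _ _ _ t u); pointwise_tac
  | |- pointwise (fun z => ?c) => apply: pointwise_const
  | |- equality_definable _ => assumption
  end.

(** The search follows the shape of the predicate by second-order patterns. An implication is also a
    product type, so its case precedes the universal quantifier; predicate variables come last and
    rely on hypotheses about them. *)
Ltac definability := cbv beta; try eassumption;
  lazymatch goal with
  | |- definable_rel _ => rewrite /definable_rel; definability
  | |- definable (fun z => (@?A z) /\ (@?B z)) => apply: (@definable_and _ _ _ _ A B); definability
  | |- definable (fun z => (@?A z) \/ (@?B z)) => apply: (@definable_or _ _ _ _ A B); definability
  | |- definable (fun z => (@?A z) <-> (@?B z)) => rewrite /iff; definability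
  | |- definable (fun z => exists y, @?V z y) => apply: (@definable_ex _ _ _ _ V); definability
  | |- definable (fun z => @?t z = @?u z) => apply: (@definable_eq _ _ _ _ _ t u); pointwise_tac
  | |- definable (fun z => mem ?r (@?t z)) =>
      apply: (@definable_preimage _ _ _ _ _ (mem r) t); [ | exact: definable_mem | pointwise_tac]
  | |- definable (fun z => (@?A z) -> (@?B z)) => apply: (@definable_imp _ _ _ _ _ A B); definability
  | |- definable (fun z => forall y, @?V z y) => apply: (@definable_all _ _ _ _ _ _ V); definability
  | |- definable _ =>
    match goal with
    | H : definable ?U |- definable (fun z => ?U (@?t z)) =>
        apply: (@definable_preimage _ _ _ _ _ U t); [ | exact: H | pointwise_tac]
    | H : definable_rel ?U |- definable (fun z => ?U (@?t z) (@?u z)) =>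
        apply: (@definable_rel_preimage _ _ _ _ _ _ U t u); [ | exact: H | pointwise_tac | pointwise_tac]
    | _ => idtac
    end
  | _ => idtac
  end; try eassumption.

(** * Categories with unique choice and effective quotients of points *)

Section PointwiseExact.
Context (E : category) (P : finprod E).

Definition unique_choice : Prop :=
  forall (X Y : E) (V : el P X -> el P Y -> Prop), definable_rel V ->
    (forall x, exists! y, V x y) -> exists f : hom X Y, forall x, V x (f ∘ x).

Definition pointwise_equivalence (T : Type) (V : T -> T -> Prop) : Prop :=
  (forall x, V x x) /\ (forall x y, V x y -> V y x) /\ (forall x y z, V x y -> V y z -> V x z).

Definition pointwise_quotients : Prop :=
  forall (X : E) (V : el P X -> el P X -> Prop), definable_rel V -> pointwise_equivalence V ->
    exists (Y : E) (q : hom X Y), surjective P q /\ forall x x', q ∘ x = q ∘ x' <-> V x x'.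

Context (Hsep : terminal_separating P).
Context (Heq : equality_definable P).
Context (Huc : unique_choice).
Context (Hquot : pointwise_quotients).
Context (Hsum : pointwise_sums P).
Context (Hcl : closed_for_pseudo_relations P).

(** * Factorisations, images and comprehension *)

Lemma injective_mono (X Y : E) (m : hom X Y) : injective_on_points P m -> is_mono m.
Proof.
move=> Hm Z u v Huv; apply: (Hsep) => z; apply: Hm.
by rewrite !comp_assoc Huv.
Qed.

Lemma mono_injective (X Y : E) (m : hom X Y) : is_mono m -> injective_on_points P m.
Proof. by move=> Hm x x'; apply: Hm. Qed.

Lemma surjective_epi (X Y Z : E) (q : hom X Y) (u v : hom Y Z) :
  surjective P q -> u ∘ q = v ∘ q -> u = v.
Proof.
by move=> Hq Huv; apply: Hsep => y; have [x <-] := Hq y; rewrite !comp_assoc Huv.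
Qed.

(** The relation [m a = f z] is total by hypothesis and single-valued by injectivity, so unique
    choice turns it into an arrow. *)
Lemma factor_injective (M X Z : E) (m : hom M X) (f : hom Z X) :
  injective_on_points P m -> (forall z : el P Z, f ∘ z ∈[m]) -> exists h : hom Z M, m ∘ h = f.
Proof.
move=> Hm Hf.
case: (Huc (V := fun (z : el P Z) (a : el P M) => m ∘ a = f ∘ z)).
- definability.
- move=> z; have [a Ha] := Hf z; exists a; split=> // b Hb.
  by apply: Hm; rewrite Ha Hb.
- by move=> h Hh; exists h; apply: (Hsep) => z; rewrite -comp_assoc Hh.
Qed.

Lemma factor_surjective (X Y Z : E) (q : hom X Y) (f : hom X Z) :
  surjective P q -> (forall x x' : el P X, q ∘ x = q ∘ x' -> f ∘ x = f ∘ x') ->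
  exists h : hom Y Z, h ∘ q = f.
Proof.
move=> Hq Hf.
case: (Huc (V := fun (y : el P Y) (z : el P Z) => exists x : el P X, q ∘ x = y /\ f ∘ x = z)).
- definability.
- move=> y; have [x Hx] := Hq y; exists (f ∘ x); split; first by exists x.
  by move=> z [x' [Hx' <-]]; apply: Hf; rewrite Hx Hx'.
- move=> h Hh; exists h; apply: (Hsep) => x; rewrite -comp_assoc.
  by have [x' [/Hf Hx' <-]] := Hh (q ∘ x).
Qed.

(** [M] is the quotient of [X] by the kernel of [f], which makes the second factor injective. *)
Lemma image_factorisation (X Y : E) (f : hom X Y) :
  exists (M : E) (e : hom X M) (m : hom M Y),
    surjective P e /\ injective_on_points P m /\ f = m ∘ e.
Proof.
case: (Hquot (V := fun x x' : el P X => f ∘ x = f ∘ x')).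
- definability.
- by split=> //; split=> // x y z -> ->.
- move=> M [e [He Hk]].
  have [m Hm] := factor_surjective He (fun x x' => proj1 (Hk x x')).
  exists M, e, m; split=> //; split=> // a b.
  have [x <-] := He a; have [y <-] := He b.
  by rewrite !comp_assoc Hm => /Hk.
Qed.

(** The image of any arrow presenting [U] has the same points; definable sets thus become
    subobjects. *)
Lemma comprehension (X : E) (U : el P X -> Prop) :
  definable U -> exists (M : E) (m : hom M X),
    injective_on_points P m /\ forall x, U x <-> x ∈[m].
Proof.
move=> [R [r Hr]]; have [M [e [m [He [Hm Hrm]]]]] := image_factorisation r.
exists M, m; split=> // x; rewrite Hr; split.
- by move=> [a <-]; exists (e ∘ a); rewrite Hrm comp_assoc.
- by move=> [b <-]; have [a <-] := He b; exists a; rewrite Hrm comp_assoc.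
Qed.

Lemma bijective_iso (X Y : E) (f : hom X Y) :
  (forall y : el P Y, exists! x : el P X, f ∘ x = y) -> is_iso f.
Proof.
move=> Hf.
have Hi : injective_on_points P f.
{ move=> x x' H; have [x0 [_ Hu]] := Hf (f ∘ x'). by rewrite -(Hu x) // -(Hu x'). }
case: (factor_injective (f := idn) Hi).
- by move=> y; have [x [Hx _]] := Hf y; exists x; rewrite comp_idl.
- move=> h Hh; exists h; split=> //.
  by apply: (injective_mono Hi); rewrite comp_assoc Hh comp_idl comp_idr.
Qed.

(** Comparison arrows with the coproduct whose points are known carry the case distinction and the
    disjointness across. *)
Lemma coproduct_elements (X Y T : E) (i : hom X T) (j : hom Y T) (Hij : is_coproduct i j) :
  (forall z : el P T, z ∈[i] \/ z ∈[j]) /\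
  (forall (x : el P X) (y : el P Y), i ∘ x <> j ∘ y).
Proof.
have [T' [i' [j' [Hij' [_ [_ [Hd Hj']]]]]]] := proj2 Hsum X Y.
have [h [[Hhi Hhj] _]] := Hij _ i' j'.
have [h' [[Hhi' Hhj'] _]] := Hij' _ i j.
have [k [_ Hk]] := Hij _ i j.
have Hhh : h' ∘ h = idn.
{ rewrite -(Hk (h' ∘ h)); first by rewrite -!comp_assoc Hhi Hhj.
  by apply: Hk; rewrite !comp_idl. }
split.
- move=> z; rewrite -(comp_idl z) -Hhh -comp_assoc.
  case: (Hj' (h ∘ z)) => [[x <-]|[y <-]]; [left; exists x | right; exists y];
    by rewrite comp_assoc ?Hhi' ?Hhj'.
- move=> x y H; apply: (Hd x y).
  by rewrite -Hhi -Hhj -!comp_assoc H.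
Qed.

(** Take the quotient by the relation that [r] induces on points. Arrows identified by it give pairs
    lying in [r] pointwise, and such a pair factors through [r] because [r] is mono. *)
Lemma equivalence_relation_effective (X R : E) (r : hom R (X × X)) :
  is_equivalence_relation r ->
  exists (Y : E) (f : hom X Y), is_pullback f f (pr1 ∘ r) (pr2 ∘ r).
Proof.
move=> [Hm [[rho Hrho] [[sigma Hsigma] [Q [p1 [p2 [[Hp HQ] [tau Htau]]]]]]]].
case: (Hquot (V := fun x x' : el P X => ⟨x, x'⟩ ∈[r])).
- definability.
- split; last split.
  + by move=> x; exists (rho ∘ x); rewrite comp_assoc Hrho; catsimp.
  + move=> x y [a Ha]; exists (sigma ∘ a).
    by rewrite comp_assoc Hsigma; catsimp; rewrite Ha; catsimp.
  + move=> x y z [a Ha] [b Hb].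
    case: (HQ one a b); first by rewrite -!comp_assoc Ha Hb; catsimp.
    move=> w [[Hw1 Hw2] _]; exists (tau ∘ w); rewrite comp_assoc Htau; catsimp.
    by rewrite Hw1 Hw2 Ha Hb; catsimp.
- move=> Y [q [Hq Hk]]; exists Y, q; split.
  + apply: (Hsep) => a; rewrite -!comp_assoc; apply/Hk; exists a.
    by rewrite [LHS]pair_uniq.
  + move=> W u v Huv.
    have [h Hh] : exists h : hom W R, r ∘ h = ⟨u, v⟩.
    { apply: factor_injective; first exact: mono_injective.
      by move=> w; catsimp; apply/Hk; rewrite !comp_assoc Huv. }
    exists h; split; first by rewrite -!comp_assoc Hh; catsimp.
    move=> h' [Hu Hv]; apply: Hm; rewrite Hh -Hu -Hv.
    by rewrite -!comp_assoc pair_eta.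
Qed.

(* A member of a full family need not be functional; the functional members, taken up to
   equality of their graphs, are exactly the sections over a fibre. *)
Lemma universal_dependent_products : has_universal_dependent_products P.
Proof.
move=> Y X I g f.
have [F [Q [phi [alpha [[Ha Hb] Hfull]]]]] := Hcl g f.
pose A (c : el P F) (x : el P X) (y : el P Y) := ⟨c, x, y⟩ ∈[alpha].
have [M [m [Hm HM]]] : exists (M : E) (m : hom M F), injective_on_points P m /\
    forall c, (forall x y y', A c x y -> A c x y' -> y = y') <-> c ∈[m].
{ by apply: comprehension; rewrite /A; definability. }
case: (Hquot (V := fun d d' : el P M => phi ∘ (m ∘ d) = phi ∘ (m ∘ d') /\
    forall x y, A (m ∘ d) x y <-> A (m ∘ d') x y)).
{ by rewrite /A; definability. }
{ split; first by [].
  split; first by move=> d d' [-> H]; split=> // x y; rewrite H.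
  by move=> d1 d2 d3 [-> H] [-> H']; split=> // x y; rewrite H. }
move=> F' [q [Hq Hk]].
have [phi' Hphi'] : exists phi' : hom F' I, phi' ∘ q = phi ∘ m.
{ by apply: factor_surjective => // d d' /Hk [H _]; rewrite -!comp_assoc. }
have [P' [alpha' [Hal Halpha']]] : exists (P' : E) (al : hom P' (F' × X × Y)),
    injective_on_points P al /\ forall w : el P (F' × X × Y),
    (exists d : el P M, q ∘ d = pr1 ∘ (pr1 ∘ w) /\ A (m ∘ d) (pr2 ∘ (pr1 ∘ w)) (pr2 ∘ w)) <->
    w ∈[al].
{ by apply: comprehension; rewrite /A; definability. }
have HA' : forall d x y, ⟨q ∘ d, x, y⟩ ∈[alpha'] <-> A (m ∘ d) x y.
{ move=> d x y; rewrite -Halpha'; catsimp; split; last by exists d.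
  by move=> [d' [/Hk [_ H]]] /H. }
exists F', P', phi', alpha'.
split; first exact: injective_mono.
split.
{ split=> [j x y | j x]; have [d <-] := Hq j.
  - by move/HA'; apply: Ha.
  - rewrite comp_assoc Hphi' -comp_assoc Hb.
    by split; move=> [y Hy]; exists y; apply/HA'. }
split.
- move=> j x x' y y'; have [d <-] := Hq j => /HA' Hy /HA' Hy' Hx; subst x'.
  have /HM Hfun : m ∘ d ∈[m] by exists d.
  exact: Hfun Hy Hy'.
- move=> R r i Hr Hrel Hfun; have [Ra Rb] := Hrel.
  have [c [Hc Hcr]] := Hfull R r i Hrel.
  have /HM [d Hd] : forall x y y', A c x y -> A c x y' -> y = y'.
  { by move=> x y y' /Hcr Hy /Hcr Hy'; apply: Hfun Hy Hy' _. }
  subst c.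
  have Hgraph : forall x y, ⟨q ∘ d, x, y⟩ ∈[alpha'] <-> ⟨x, y⟩ ∈[r].
  { move=> x y; rewrite HA'; split; first exact: Hcr.
    (* Fullness only includes the graph of [c] in [r]. Both are total over the fibre of [i] and [r]
       is functional, so they agree. *)
    move=> Hxy; have : f ∘ x = i by apply/Rb; exists y.
    rewrite -Hc => /Hb [y' Hy'].
    by rewrite (Hfun x x y y' Hxy (Hcr _ _ Hy')). }
  exists (q ∘ d); split; first by rewrite comp_assoc Hphi' -comp_assoc.
  move=> c'; have [d' <-] := Hq c'; rewrite comp_assoc Hphi' -comp_assoc => [[Hc' Hg']].
  apply/Hk; split; first by rewrite Hc Hc'.
  by move=> x y; rewrite -!HA' Hgraph Hg'.
Qed.

(** The dependent product of [X × Y → X] along [X → one] collects the sections of the projection,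
    that is, the graphs of arrows. Unique choice turns membership in [alpha] into evaluation. *)
Lemma function_space (X Y : E) :
  exists (F : E) (ev : hom (F × X) Y),
    forall h : hom X Y, exists c : el P F, forall x : el P X, ev ∘ ⟨c, x⟩ = h ∘ x.
Proof.
have [F [Q [phi [alpha [Hal [[Ha Hb] [Hfun Huniv]]]]]]] :=
  universal_dependent_products (pr1 : hom (X × Y) X) (bang X).
case: (Huc (V := fun (w : el P (F × X)) (y : el P Y) =>
    ⟨pr1 ∘ w, pr2 ∘ w, ⟨pr2 ∘ w, y⟩⟩ ∈[alpha])).
- definability.
- move=> w; have /Hb [z Hz] : bang X ∘ (pr2 ∘ w) = phi ∘ (pr1 ∘ w) by exact: bang_eq.
  have Hz1 := Ha _ _ _ Hz; exists (pr2 ∘ z).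
  have Ez : ⟨pr2 ∘ w, pr2 ∘ z⟩ = z by rewrite -Hz1 pair_eta.
  split; first by rewrite Ez.
  move=> y Hy.
  by rewrite (Hfun _ _ _ _ _ Hz Hy) // pr2_pair.
- move=> ev Hev; exists F, ev => h.
  have Hmem : forall x z, ⟨x, z⟩ ∈[⟨idn, ⟨idn, h⟩⟩] <-> z = ⟨x, h ∘ x⟩.
  { move=> x z; split; last by move=> ->; exists x; catsimp.
    by move=> [x']; catsimp => /pair_inj [-> <-]. }
  case: (Huniv X ⟨idn, ⟨idn, h⟩⟩ idn).
  + by move=> Z u v; catsimp => /pair_inj [].
  + split; first by move=> x z /Hmem ->; rewrite pr1_pair.
    move=> x; split=> [_|_]; last exact: bang_eq.
    by exists ⟨x, h ∘ x⟩; apply/Hmem.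
  + by move=> x x' z z' /Hmem -> /Hmem -> ->.
  + move=> c [[_ Hc] _]; exists c => x.
    have := Hev ⟨c, x⟩; rewrite pr1_pair pr2_pair => /Hc /Hmem H.
    by have [] := pair_inj H.
Qed.

(** * The natural numbers object *)

Lemma nno_of_weak_nno : has_weak_nno P -> has_nno P.
Proof.
move=> [N [z [s Hrec]]].
(* Codes in [F] replace arrows from [N] to [N], so that being fixed by all endomorphisms becomes a
   definable condition on points. *)
have [F [ev Hev]] := function_space N N.
(* The points fixed by every endomorphism of (N, z, s): every endomorphism [k] of this subobject
   is the identity, as [k] composed with the retraction [t] is an endomorphism of (N, z, s). *)
have [M [m [Hm HM]]] : exists (M : E) (m : hom M N), injective_on_points P m /\
    forall n, (forall k : el P F, ev ∘ ⟨k, z⟩ = z ->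
      (forall a : el P N, ev ∘ ⟨k, s ∘ a⟩ = s ∘ (ev ∘ ⟨k, a⟩)) -> ev ∘ ⟨k, n⟩ = n) <-> n ∈[m].
{ by apply: comprehension; definability. }
have Hfix : forall (k : hom N N) (a : el P M), k ∘ z = z -> k ∘ s = s ∘ k -> k ∘ (m ∘ a) = m ∘ a.
{ move=> k a Hz Hs; have /HM Ha : m ∘ a ∈[m] by exists a.
  have [c Hc] := Hev k; rewrite -Hc; apply: Ha; first by rewrite Hc.
  by move=> b; rewrite !Hc !comp_assoc Hs. }
have [z' Hz'] : z ∈[m] by apply/HM.
have [s' Hs'] : exists s' : hom M M, m ∘ s' = s ∘ m.
{ apply: factor_injective => // a; apply/HM => k Hk1 Hk2.
  have /HM Ha : m ∘ a ∈[m] by exists a.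
  by rewrite -comp_assoc Hk2 Ha. }
have [t [Htz Hts]] := Hrec M z' s'.
have Htm : t ∘ m = idn.
{ apply: (injective_mono Hm); apply: (Hsep) => a.
  rewrite comp_idr -!comp_assoc (comp_assoc m t (m ∘ a)); apply: Hfix.
  - by rewrite -comp_assoc Htz.
  - by rewrite -comp_assoc Hts !comp_assoc Hs'. }
have Hendo : forall k : hom M M, k ∘ z' = z' -> k ∘ s' = s' ∘ k -> k = idn.
{ move=> k Hkz Hks; apply: (Hsep) => a; apply: Hm.
  rewrite comp_idl -[in RHS](Hfix (m ∘ k ∘ t) a).
  - by rewrite -!comp_assoc Htz Hkz.
  - by rewrite -!comp_assoc Hts (comp_assoc k) Hks !comp_assoc Hs'.
  - by rewrite -!comp_assoc (comp_assoc t) Htm comp_idl. }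
exists M, z', s' => X x f.
have [g0 [Hg0 Hg0s]] := Hrec X x f.
have Hex : g0 ∘ m ∘ z' = x /\ g0 ∘ m ∘ s' = f ∘ (g0 ∘ m).
{ by split; rewrite -comp_assoc ?Hz' // Hs' !comp_assoc Hg0s. }
exists (g0 ∘ m); split=> // g' [Hg' Hg's].
case: Hex; move: (g0 ∘ m) => g Hg Hgs.
(* The equaliser [E'] of two solutions contains zero and is closed under successor. Recursion into
   it gives [h], and [e ∘ (h ∘ m)] is an endomorphism of [M], hence the identity; so every point of
   [M] lies in [E']. *)
have [E' [e [He HE']]] := comprehension (Heq g g').
have [z'' Hz''] : z' ∈[e] by apply/HE'; rewrite Hg Hg'.
have [s'' Hs''] : exists s'' : hom E' E', e ∘ s'' = s' ∘ e.
{ apply: factor_injective => // b; apply/HE'.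
  have /HE' Hb : e ∘ b ∈[e] by exists b.
  by rewrite -comp_assoc !(comp_assoc _ s') Hgs Hg's -!comp_assoc Hb. }
have [h [Hhz Hhs]] := Hrec E' z'' s''.
have Hid : e ∘ (h ∘ m) = idn.
{ apply: Hendo; first by rewrite -!comp_assoc Hz' Hhz.
  by rewrite -!comp_assoc Hs' (comp_assoc h) Hhs !comp_assoc Hs''. }
apply: (Hsep) => a; apply/HE'; exists (h ∘ m ∘ a).
by rewrite comp_assoc Hid comp_idl.
Qed.

(** * Induction and generated equivalence relations *)

Section Recursion.
Context (N : E) (z : el P N) (s : hom N N).
Context (Hrec : forall (X : E) (x : el P X) (f : hom X X),
  exists! g : hom N X, g ∘ z = x /\ g ∘ s = f ∘ g).

Lemma nno_endo (k : hom N N) : k ∘ z = z -> k ∘ s = s ∘ k -> k = idn.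
Proof.
move=> Hz Hs; have [g [_ Hg]] := Hrec z s.
by rewrite -(Hg k (conj Hz Hs)); apply: Hg; rewrite !comp_idl comp_idr.
Qed.

(** Recursion into the subobject cut out by [U] yields [g] with [m ∘ g] an endomorphism of [N],
    hence the identity; so every point lies in [U]. *)
Lemma nno_induction (U : el P N -> Prop) :
  definable U -> U z -> (forall n, U n -> U (s ∘ n)) -> forall n, U n.
Proof.
move=> HU Uz Us n; have [M [m [Hm HM]]] := comprehension HU.
have [z' Hz'] : z ∈[m] by apply/HM.
have [s' Hs'] : exists s' : hom M M, m ∘ s' = s ∘ m.
{ apply: factor_injective => // a; apply/HM; rewrite -comp_assoc.
  by apply: Us; apply/HM; exists a. }
have [g [[Hgz Hgs] _]] := Hrec z' s'.
apply/HM; exists (g ∘ n); rewrite comp_assoc.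
by rewrite (nno_endo (k := m ∘ g)) ?comp_idl // -comp_assoc ?Hgz // Hgs !comp_assoc Hs'.
Qed.

(** The recursion carries a counter: the first component at [n] is [n] itself, so the second
    component at [s n] is [p n]. *)
Lemma nno_cons (X : E) (x : el P X) (p : hom N X) :
  exists g : hom N X, g ∘ z = x /\ g ∘ s = p.
Proof.
have [g [[Hgz Hgs] _]] := Hrec ⟨z, x⟩ ⟨s ∘ pr1, p ∘ pr1⟩.
have Hid : pr1 ∘ g = idn.
{ apply: nno_endo; rewrite -comp_assoc ?Hgz ?pr1_pair // Hgs; catsimp.
  by []. }
exists (pr2 ∘ g); rewrite -!comp_assoc Hgz Hgs; catsimp; split=> //.
by rewrite Hid comp_idr.
Qed.

(* [T x y] says that a chain of [V]-steps indexed by [N] leads from [x] to [y].  Recursion extends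
   a chain at its front only, whence the detour through the Euclidean property. *)
Lemma generated_equivalence (X : E) (V : el P X -> el P X -> Prop) :
  definable_rel V -> (forall x, V x x) -> (forall x y, V x y -> V y x) ->
  exists T : el P X -> el P X -> Prop,
    definable_rel T /\ pointwise_equivalence T /\ (forall x y, V x y -> T x y) /\
    forall (Z : E) (h : hom X Z), (forall x y, V x y -> h ∘ x = h ∘ y) ->
      forall x y, T x y -> h ∘ x = h ∘ y.
Proof.
move=> HV Vrefl Vsym; have [F [ev Hev]] := function_space N X.
pose T (x y : el P X) := exists (c : el P F) (n : el P N),
  ev ∘ ⟨c, z⟩ = x /\ ev ∘ ⟨c, n⟩ = y /\ forall m, V (ev ∘ ⟨c, m⟩) (ev ∘ ⟨c, s ∘ m⟩).
have HT : definable_rel T by rewrite /T; definability.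
have Trefl : forall x, T x x.
{ move=> x; have [c Hc] := Hev (x ∘ bang N); exists c, z.
  have Hx : forall m, ev ∘ ⟨c, m⟩ = x.
  { by move=> m; rewrite Hc -comp_assoc (point_one (bang N ∘ m)) comp_idr. }
  by rewrite Hx; split=> //; split=> // m; rewrite !Hx. }
have Tcons : forall w x y, V w x -> T x y -> T w y.
{ move=> w x y Hwx [c [n [Hx [Hy Hc]]]].
  have [g [Hgz Hgs]] := nno_cons w (ev ∘ ⟨c ∘ bang N, idn⟩).
  have Hg : forall m : el P N, g ∘ (s ∘ m) = ev ∘ ⟨c, m⟩.
  { by move=> m; rewrite comp_assoc Hgs; catsimp; rewrite (point_one (bang N ∘ m)) comp_idr. }
  have [d Hd] := Hev g; exists d, (s ∘ n); rewrite !Hd Hg; split=> //; split=> // m.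
  (* Induction acts here as a case distinction between [z] and a successor. *)
  rewrite !Hd Hg; move: m; apply: nno_induction; first by definability.
  - by rewrite Hgz Hx.
  - by move=> m _; rewrite Hg. }
have Teuclid : forall x y y', T x y -> T x y' -> T y y'.
{ move=> x y y' [c [n [Hx [<- Hc]]]] Hy'; move: n.
  (* The chain from [x] is followed up to [n]; each step is reversed by symmetry and put in front of
     a chain ending at [y']. *)
  apply: nno_induction; first by rewrite /T; definability.
  - by rewrite Hx.
  - by move=> n; apply: Tcons; apply: Vsym; apply: Hc. }
exists T; split=> //; split; last split.
- split=> //; split=> [x y H | x y w H H']; first exact: Teuclid H (Trefl x).
  by apply: (Teuclid y) => //; apply: Teuclid H (Trefl x).
- by move=> x y H; apply: Tcons H (Trefl y).
- move=> Z h Hh x y [c [n [Hx [<- Hc]]]]; move: n.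
  apply: nno_induction; first by definability.
  + by rewrite Hx.
  + by move=> n ->; apply: Hh; apply: Hc.
Qed.

End Recursion.

(** * Finite limits and colimits *)

Lemma definable_all_finite (I : Type) (HI : Finite I) (X : E) (U : I -> el P X -> Prop) :
  (forall i, definable (U i)) -> definable (fun x => forall i, U i x).
Proof.
move=> HU; have [l Hl] := HI.
have : definable (fun x => forall i, In i l -> U i x).
{ elim: l {Hl} => [|i l IHl].
  - by apply: definable_ext (definable_true P X) => x; split.
  - apply: definable_ext (definable_and Heq (HU i) IHl) => x; split.
    + by move=> [H1 H2] j [<-|]; [exact: H1 | exact: H2].
    + by move=> H; split=> [|j Hj]; apply: H; [left | right]. }
by apply: definable_ext => x; split=> H i => [|_]; apply: H.
Qed.

Lemma definable_ex_finite (I : Type) (HI : Finite I) (X : E) (U : I -> el P X -> Prop) :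
  (forall i, definable (U i)) -> definable (fun x => exists i, U i x).
Proof.
move=> HU; have [l Hl] := HI.
have : definable (fun x => exists i, In i l /\ U i x).
{ elim: l {Hl} => [|i l IHl].
  - by apply: definable_ext (definable_false Hsum X) => x; split; [by [] | by move=> [i [[] _]]].
  - apply: definable_ext (definable_or Hsum (HU i) IHl) => x; split.
    + by case=> [H|[j [Hj H]]]; [exists i | exists j]; split=> //; [left | right].
    + by move=> [j [[<-|Hj] H]]; [left | right; exists j]. }
by apply: definable_ext => x; split=> [[i [_ H]] | [i H]]; exists i.
Qed.

Lemma in_tail (I : Type) (i j : I) (l : list I) : In j (i :: l) -> i <> j -> In j l.
Proof. by move=> [H | H] H'. Qed.

(** Only the existence of [w] is asserted: the enumerating list may repeat an index, each projection
    reads the first occurrence, and later coordinates stay undetermined. *)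
Lemma weak_finite_product (I : Type) (HI : Finite I) (D : I -> E) :
  exists (W : E) (p : forall i, hom W (D i)),
    forall x : (forall i, el P (D i)), exists w : el P W, forall i, p i ∘ w = x i.
Proof.
have [l Hl] := HI.
suff [W [p Hp]] : exists (W : E) (p : forall i, In i l -> hom W (D i)),
    forall x : (forall i, el P (D i)), exists w : el P W, forall i H, p i H ∘ w = x i.
{ exists W, (fun i => p i (Hl i)) => x; have [w Hw] := Hp x.
  by exists w. }
elim: l {Hl} => [|i l [W [p Hp]]].
- by exists one, (fun i (H : In i nil) => match (H : False) with end) => x; exists idn.
- exists (D i × W), (fun j H =>
    match excluded_middle_informative (i = j) with
    | left e => match e in _ = k return hom (D i × W) (D k) with eq_refl => pr1 end
    | right n => p j (in_tail H n) ∘ pr2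
    end) => x.
  have [w Hw] := Hp x; exists ⟨x i, w⟩ => j H.
  case: (excluded_middle_informative (i = j)) => [e | n].
  + by case: j / e H => H; rewrite pr1_pair.
  + by rewrite -comp_assoc pr2_pair.
Qed.

(** Equality of dependent pairs states at once that the summands coincide and that the points do. *)
Lemma pointwise_finite_sum (I : Type) (HI : Finite I) (D : I -> E) :
  exists (W : E) (c : forall i, hom (D i) W),
    (forall w : el P W, exists i (x : el P (D i)), c i ∘ x = w) /\
    (forall i j (x : el P (D i)) (y : el P (D j)), c i ∘ x = c j ∘ y ->
      existT (fun i => el P (D i)) i x = existT (fun i => el P (D i)) j y).
Proof.
have [l Hl] := HI.
suff [W [c [Hsurj Hinj]]] : exists (W : E) (c : forall i, In i l -> hom (D i) W),
    (forall w : el P W, exists i H (x : el P (D i)), c i H ∘ x = w) /\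
    (forall i j H H' (x : el P (D i)) (y : el P (D j)), c i H ∘ x = c j H' ∘ y ->
      existT (fun i => el P (D i)) i x = existT (fun i => el P (D i)) j y).
{ exists W, (fun i => c i (Hl i)); split; last by move=> i j x y /Hinj.
  move=> w; have [i [H [x <-]]] := Hsurj w; exists i, x.
  by rewrite (proof_irrelevance _ (Hl i) H). }
elim: l {Hl} => [|i l [W [c [Hsurj Hinj]]]].
- have [O [HO HO']] := proj1 Hsum.
  by exists O, (fun i (H : In i nil) => match (H : False) with end); split=> [w | i j []]; case: (HO' w).
(* A repeated index adds no summand, so that each [D i] is present once in [W]. *)
- case: (classic (In i l)) => Hi.
  { have Hin : forall j, In j (i :: l) -> In j l by move=> j [<-|].
    exists W, (fun j H => c j (Hin j H)); split; last by move=> j k H H' x y /Hinj.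
    move=> w; have [j [H [x <-]]] := Hsurj w; exists j, (or_intror H), x.
    by rewrite (proof_irrelevance _ (Hin j (or_intror H)) H). }
  have [T [inj1 [inj2 [_ [Hi1 [Hi2 [Hd Hj]]]]]]] := proj2 Hsum (D i) W.
  exists T, (fun j H =>
    match excluded_middle_informative (i = j) with
    | left e => match e in _ = k return hom (D k) T with eq_refl => inj1 end
    | right n => inj2 ∘ c j (in_tail H n)
    end); split.
  + move=> w; case: (Hj w) => [[x <-] | [w' <-]].
    * exists i, (or_introl eq_refl), x.
      case: (excluded_middle_informative (i = i)) => // e.
      by rewrite (proof_irrelevance _ e eq_refl).
    * have [j [H [x <-]]] := Hsurj w'; exists j, (or_intror H), x.
      case: (excluded_middle_informative (i = j)) => [e | n]; first by case: Hi; rewrite e.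
      by rewrite comp_assoc (proof_irrelevance _ (in_tail _ _) H).
  + move=> j k H H' x y.
    case: (excluded_middle_informative (i = j)) => [e | n];
    case: (excluded_middle_informative (i = k)) => [e' | n'].
    * case: j / e x H => x _; case: k / e' y H' => y _.
      by move/Hi1 => ->.
    * case: j / e x H => x _; rewrite -comp_assoc => E'.
      by case: (Hd _ _ E').
    * case: k / e' y H' => y _; rewrite -comp_assoc => E'.
      by case: (Hd _ _ (eq_sym E')).
    * by rewrite -!comp_assoc => /Hi2 /Hinj.
Qed.

Lemma dependent_function_choice (I : Type) (B : I -> Type) (R : forall i, B i -> Prop) :
  (forall i, exists y, R i y) -> exists f : forall i, B i, forall i, R i (f i).
Proof.
move=> H; exists (fun i => proj1_sig (constructive_indefinite_description _ (H i))) => i.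
exact: proj2_sig.
Qed.

(** Coordinates separate the points of [L], so a compatible family determines one point and unique
    choice yields the mediating arrow. *)
Lemma finite_limits : has_finite_limits E.
Proof.
move=> J D [HJ Hhom].
have [W [p Hp]] := weak_finite_product HJ D.
have [M [m [Hm HM]]] : exists (M : E) (m : hom M W), injective_on_points P m /\
    forall w, (forall (a b : J) (u : hom a b), fhom D u ∘ (p a ∘ w) = p b ∘ w) <-> w ∈[m].
{ apply: comprehension; apply: definable_all_finite => // a; apply: definable_all_finite => // b.
  by apply: definable_all_finite => // u; definability. }
(* [p] may repeat factors, so the compatible families are identified when they agree. *)
case: (Hquot (V := fun c c' : el P M => forall a : J, p a ∘ (m ∘ c) = p a ∘ (m ∘ c'))).
{ by apply: definable_all_finite => // a; definability. }
{ by split=> //; split=> [x y H a | x y z H H' a]; rewrite H. }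
move=> L [q [Hq Hk]].
have [pi Hpi] : exists pi : forall a : J, hom L (D a), forall a, pi a ∘ q = p a ∘ m.
{ apply: (dependent_function_choice (B := fun a => hom L (D a))
    (R := fun a f => f ∘ q = p a ∘ m)) => a.
  by apply: factor_surjective => // c c' /Hk H; rewrite -!comp_assoc. }
exists L, pi; split.
- move=> a b u; apply: (surjective_epi Hq); apply: (Hsep) => c.
  rewrite -!comp_assoc (comp_assoc (pi a)) (comp_assoc (pi b)) !Hpi -!comp_assoc.
  by move: a b u; apply/HM; exists c.
- move=> Z r Hr.
  have Huni : forall l l' : el P L, (forall a, pi a ∘ l = pi a ∘ l') -> l = l'.
  { move=> l l'; have [c <-] := Hq l; have [c' <-] := Hq l' => H; apply/Hk => a.
    by move: (H a); rewrite !comp_assoc !Hpi. }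
  case: (Huc (V := fun (z : el P Z) (l : el P L) => forall a, pi a ∘ l = r a ∘ z)).
  + by apply: definable_all_finite => // a; definability.
  + move=> z; have [w Hw] := Hp (fun a => r a ∘ z).
    have /HM [c Hc] : forall (a b : J) (u : hom a b), fhom D u ∘ (p a ∘ w) = p b ∘ w.
    { by move=> a b u; rewrite !Hw comp_assoc Hr. }
    have Hqc : forall a, pi a ∘ (q ∘ c) = r a ∘ z.
    { by move=> a; rewrite comp_assoc Hpi -comp_assoc Hc. }
    by exists (q ∘ c); split=> // l Hl; apply: Huni => a; rewrite Hl Hqc.
  + move=> h Hh; exists h; split.
    * by move=> a; apply: (Hsep) => z; rewrite -comp_assoc Hh.
    * move=> h' Hh'; apply: (Hsep) => z; apply: Huni => a.
      by rewrite Hh comp_assoc Hh'.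
Qed.

(** The colimit is the finite sum of the objects modulo the equivalence generated by the arrows of
    the diagram. *)
Lemma finite_colimits (Hnno : has_nno P) : has_finite_colimits E.
Proof.
move=> J D [HJ Hhom].
have [N [z [s Hrec]]] := Hnno.
have [W [c [Hc Hinj]]] := pointwise_finite_sum HJ D.
(* Reflexivity and symmetry are built in, as [generated_equivalence] requires. *)
pose V (w w' : el P W) := w = w' \/ exists (a b : J) (u : hom a b), exists x : el P (D a),
  (w = c a ∘ x /\ w' = c b ∘ (fhom D u ∘ x)) \/ (w' = c a ∘ x /\ w = c b ∘ (fhom D u ∘ x)).
have HV : definable_rel V.
{ apply: definable_or => //; first by definability.
  apply: definable_ex_finite => // a; apply: definable_ex_finite => // b.
  by apply: definable_ex_finite => // u; definability. }
have [T [HT [HTe [HVT HTmin]]]] : exists T : el P W -> el P W -> Prop,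
    definable_rel T /\ pointwise_equivalence T /\ (forall x y, V x y -> T x y) /\
    forall (Z : E) (h : hom W Z), (forall x y, V x y -> h ∘ x = h ∘ y) ->
      forall x y, T x y -> h ∘ x = h ∘ y.
{ apply: generated_equivalence Hrec _ _ HV _ _; first by left.
  move=> w w' [-> | [a [b [u [x H]]]]]; [by left | right; exists a, b, u, x].
  by case: H; [right | left]. }
have [L [q [Hq Hk]]] := Hquot HT HTe.
exists L, (fun a => q ∘ c a); split.
- move=> a b u; apply: (Hsep) => x; rewrite -!comp_assoc; apply/Hk.
  case: HTe => [_ [Tsym _]]; apply: Tsym; apply: HVT; right.
  by exists a, b, u, x; left.
- move=> Z r Hr.
  have Hrc : forall a b (x : el P (D a)) (y : el P (D b)), c a ∘ x = c b ∘ y -> r a ∘ x = r b ∘ y.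
  { move=> a b x y /Hinj Hxy.
    exact: (f_equal (fun t : {a : J & el P (D a)} => r (projT1 t) ∘ projT2 t) Hxy). }
  (* The cocone is glued on points: [Hc] makes the relation total and [Hrc] makes it
     single-valued. *)
  have [h Hh] : exists h : hom W Z, forall a, h ∘ c a = r a.
  { case: (Huc (V := fun (w : el P W) (y : el P Z) =>
      exists a, exists x : el P (D a), c a ∘ x = w /\ r a ∘ x = y)).
    - by apply: definable_ex_finite => // a; definability.
    - move=> w; have [a [x <-]] := Hc w; exists (r a ∘ x); split; first by exists a, x.
      by move=> y [b [x' [Hx <-]]]; apply: Hrc.
    - move=> h Hh; exists h => a; apply: (Hsep) => x; rewrite -comp_assoc.
      by have [b [x' [Hx <-]]] := Hh (c a ∘ x); apply: Hrc. }
  have HhV : forall w w', V w w' -> h ∘ w = h ∘ w'.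
  { have Hx : forall (a b : J) (u : hom a b) (x : el P (D a)),
      h ∘ (c a ∘ x) = h ∘ (c b ∘ (fhom D u ∘ x)).
    { by move=> a b u x; rewrite !comp_assoc !Hh Hr. }
    by move=> w w' [-> // | [a [b [u [x [[-> ->] | [-> ->]]]]]]]; rewrite (Hx a b u). }
  have [k Hkk] : exists k : hom L Z, k ∘ q = h.
  { by apply: factor_surjective => // w w' /Hk; apply: HTmin. }
  exists k; split; first by move=> a; rewrite comp_assoc Hkk.
  move=> k' Hk'; apply: (surjective_epi Hq); apply: (Hsep) => w.
  have [a [x <-]] := Hc w.
  by rewrite !(comp_assoc _ (c a)) -(comp_assoc k') Hk' Hkk Hh.
Qed.

Theorem CETCS_of_pointwise
  (Hcov : forall Y : E, exists (X : E) (f : hom X Y), choice_object P X /\ surjective P f)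
  (Hwn : has_weak_nno P) : CETCS P.
Proof.
have Hnno := nno_of_weak_nno Hwn.
split=> //.
- by split; [exact: finite_limits | exact: finite_colimits].
- exact: universal_dependent_products.
- by split=> //; exact: bijective_iso.
- move=> O HO o; have [O' [_ HO']] := proj1 Hsum.
  by have [f _] := HO O'; apply: HO'; exact: (f ∘ o).
- by move=> X Y T i j /coproduct_elements [].
- move=> T i j /coproduct_elements [_ H] Hij.
  by apply: (H idn idn); rewrite Hij.
- move=> X Y f; have [M [e [m [He [Hm Hf]]]]] := image_factorisation f.
  by exists M, e, m; split=> //; split=> //; exact: injective_mono.
- exact: equivalence_relation_effective.
Qed.

End PointwiseExact.

(** * Points of the exact completion *)

Section ExactCompletionPoints.
Context (C : category) (P : finprod C).
Context (HE : has_weak_equalisers C).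
Context (Hchoice : forall X : C, choice_object P X).

(** * Choice and pseudo-equivalence relations in terms of points *)

Lemma choice_equality_definable : equality_definable P.
Proof.
move=> X Y f g; have [R [e [He Hu]]] := HE f g; exists R, e => x; split.
- exact: Hu.
- by move=> [a <-]; rewrite !comp_assoc He.
Qed.
Let Heq := choice_equality_definable.

(** In the weak pullback of [f] and [r], the leg to [X] is surjective by hypothesis; a section of it
    followed by the other leg is the factorisation. *)
Lemma factor_points (X Y Z : C) (f : hom X Y) (r : hom Z Y) :
  (forall x : el P X, f ∘ x ∈[r]) -> exists h : hom X Z, r ∘ h = f.
Proof.
move=> Hf; have [R [e [He Hu]]] := HE (f ∘ pr1) (r ∘ pr2 : hom (X × Z) Y).
have [t Ht] : exists t, (pr1 ∘ e) ∘ t = idn.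
{ apply: Hchoice => x; have [a Ha] := Hf x.
  case: (Hu one ⟨x, a⟩); first by catsimp.
  by move=> b Hb; exists b; rewrite -comp_assoc Hb pr1_pair. }
exists (pr2 ∘ e ∘ t).
by rewrite !comp_assoc -He -!comp_assoc (comp_assoc pr1) Ht comp_idr.
Qed.

Lemma relation_choice (X Y : C) (V : el P X -> el P Y -> Prop) :
  definable_rel V -> (forall x, exists y, V x y) -> exists f : hom X Y, forall x, V x (f ∘ x).
Proof.
move=> [R [r Hr]] Htot.
have [t Ht] : exists t, (pr1 ∘ r) ∘ t = idn.
{ apply: Hchoice => x; have [y Hy] := Htot x.
  have /Hr [a Ha] : V (pr1 ∘ ⟨x, y⟩) (pr2 ∘ ⟨x, y⟩) by rewrite pr1_pair pr2_pair.
  by exists a; rewrite -comp_assoc Ha pr1_pair. }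
exists (pr2 ∘ r ∘ t) => x.
have /Hr : r ∘ (t ∘ x) ∈[r] by exists (t ∘ x).
by rewrite !comp_assoc Ht comp_idl.
Qed.

(** The arrows for reflexivity, symmetry and transitivity all come from [factor_points]. *)
Lemma pseudo_equivalence_of_points (X R : C) (r : hom R (X × X)) :
  pointwise_equivalence (fun x y : el P X => ⟨x, y⟩ ∈[r]) -> is_pseudo_equivalence_relation r.
Proof.
move=> [Hrefl [Hsym Htrans]]; split; last split.
- by apply: factor_points => x; rewrite pair_comp comp_idl.
- apply: factor_points => a; rewrite pair_comp; apply: Hsym.
  by exists a; rewrite -!comp_assoc pair_eta.
- have [Q [e [He Hu]]] := HE (pr2 ∘ r ∘ pr1) (pr1 ∘ r ∘ pr2 : hom (R × R) X).
  exists Q, (pr1 ∘ e), (pr2 ∘ e); split; first split.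
  + by rewrite !comp_assoc.
  + move=> W u v Huv; case: (Hu W ⟨u, v⟩).
    * by rewrite -!(comp_assoc _ _ ⟨u, v⟩) pr1_pair pr2_pair.
    * by move=> h Hh; exists h; rewrite -!comp_assoc Hh pr1_pair pr2_pair.
  + apply: factor_points => x; rewrite pair_comp -!comp_assoc.
    apply: (Htrans _ (pr2 ∘ (r ∘ (pr1 ∘ (e ∘ x))))).
    * by exists (pr1 ∘ (e ∘ x)); rewrite pair_eta.
    * exists (pr2 ∘ (e ∘ x)).
      by rewrite !comp_assoc He -!comp_assoc pair_eta.
Qed.

Lemma ex_sim_points (X : C) (A : ex_ob P) (f g : hom X (ex_carrier A)) :
  ex_sim f g <-> forall x : el P X, ex_sim (f ∘ x) (g ∘ x).
Proof.
split=> [H x | H]; first exact: ex_sim_precomp.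
by apply: factor_points => x; rewrite pair_comp; apply: H.
Qed.

Lemma extensional_points (A B : ex_ob P) (f : hom (ex_carrier A) (ex_carrier B)) :
  extensional f <-> forall x y : el P (ex_carrier A), ex_sim x y -> ex_sim (f ∘ x) (f ∘ y).
Proof.
split=> [H x y | H]; first exact: ex_sim_postcomp.
apply: factor_points => a; rewrite /prod_map; catsimp; apply: H.
by exists a; rewrite pair_eta.
Qed.

(** Quotients and sums in the completion are built by this lemma. *)
Lemma ex_ob_of_equivalence (X : C) (V : el P X -> el P X -> Prop) :
  definable_rel V -> pointwise_equivalence V ->
  exists (R : C) (r : hom R (X × X)) (Hr : is_pseudo_equivalence_relation r),
    forall x y : el P X, ex_sim (s := ExOb Hr) x y <-> V x y.
Proof.
move=> [R [r Hr]] [Hrefl [Hsym Htrans]].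
have HrV : forall x y, ⟨x, y⟩ ∈[r] <-> V x y by move=> x y; rewrite -Hr pr1_pair pr2_pair.
suff Hp : is_pseudo_equivalence_relation r by exists R, r, Hp.
apply: pseudo_equivalence_of_points; split; last split.
- by move=> x; apply/HrV.
- by move=> x y /HrV H; apply/HrV; apply: Hsym.
- by move=> x y z /HrV H /HrV H'; apply/HrV; apply: Htrans H H'.
Qed.

(** * Discrete objects and finite products *)

Lemma discrete_pseudo_equivalence (X : C) :
  is_pseudo_equivalence_relation (⟨idn, idn⟩ : hom X (X × X)).
Proof.
apply: pseudo_equivalence_of_points; split; last split.
- by move=> x; exists x; catsimp.
- by move=> x y [z]; catsimp => /pair_inj [-> ->]; exists y; catsimp.
- by move=> x y z [w]; catsimp => /pair_inj [-> ->].
Qed.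

Definition discrete (X : C) : ex_ob P := ExOb (discrete_pseudo_equivalence X).

Lemma ex_sim_discrete (X : C) (x y : el P X) : ex_sim (s := discrete X) x y <-> x = y.
Proof.
split; last by move=> ->; apply: ex_sim_refl.
by move=> [z]; rewrite /discrete /=; catsimp => /pair_inj [<- <-].
Qed.

Lemma extensional_discrete (X : C) (A : ex_ob P) (f : hom X (ex_carrier A)) :
  extensional (r := discrete X) f.
Proof. by apply/extensional_points => x y /ex_sim_discrete ->; apply: ex_sim_refl. Qed.

Definition ex_prod_rel (A B : ex_ob P) :
    hom (ex_dom A × ex_dom B) ((ex_carrier A × ex_carrier B) × (ex_carrier A × ex_carrier B)) :=
  ⟨⟨pr1 ∘ A ∘ pr1, pr1 ∘ B ∘ pr2⟩, ⟨pr2 ∘ A ∘ pr1, pr2 ∘ B ∘ pr2⟩⟩.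

Lemma ex_prod_rel_mem (A B : ex_ob P) (z w : el P (ex_carrier A × ex_carrier B)) :
  ⟨z, w⟩ ∈[ex_prod_rel A B] <->
  ex_sim (s := A) (pr1 ∘ z) (pr1 ∘ w) /\ ex_sim (s := B) (pr2 ∘ z) (pr2 ∘ w).
Proof.
rewrite /ex_prod_rel; split.
- move=> [c]; catsimp => /pair_inj [<- <-]; rewrite !pr1_pair !pr2_pair.
  by split; [exists (pr1 ∘ c) | exists (pr2 ∘ c)]; rewrite pair_eta.
- move=> [[a Ha] [b Hb]]; exists ⟨a, b⟩; catsimp; rewrite Ha Hb.
  by rewrite !pr1_pair !pr2_pair !pair_eta.
Qed.

Lemma ex_prod_pseudo_equivalence (A B : ex_ob P) :
  is_pseudo_equivalence_relation (ex_prod_rel A B).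
Proof.
apply: pseudo_equivalence_of_points; split; last split.
- by move=> z; apply/ex_prod_rel_mem; split; apply: ex_sim_refl.
- by move=> z w /ex_prod_rel_mem [H1 H2]; apply/ex_prod_rel_mem; split; apply: ex_sim_sym.
- move=> z w v /ex_prod_rel_mem [H1 H2] /ex_prod_rel_mem [H3 H4].
  by apply/ex_prod_rel_mem; split; [apply: ex_sim_trans H1 H3 | apply: ex_sim_trans H2 H4].
Qed.

Definition ex_prod (A B : ex_ob P) : ex_ob P := ExOb (ex_prod_pseudo_equivalence A B).

Lemma ex_sim_prod (X : C) (A B : ex_ob P) (f g : hom X (ex_carrier A × ex_carrier B)) :
  ex_sim (s := ex_prod A B) f g <->
  ex_sim (s := A) (pr1 ∘ f) (pr1 ∘ g) /\ ex_sim (s := B) (pr2 ∘ f) (pr2 ∘ g).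
Proof.
rewrite !ex_sim_points; split.
- by move=> H; split=> x; rewrite -!comp_assoc; have /ex_prod_rel_mem [] := H x.
- by move=> [H1 H2] x; apply/ex_prod_rel_mem; rewrite !comp_assoc.
Qed.

Lemma extensional_pr1 (A B : ex_ob P) : extensional (r := ex_prod A B) (s := A) pr1.
Proof. by apply/extensional_points => x y /ex_sim_prod []. Qed.

Lemma extensional_pr2 (A B : ex_ob P) : extensional (r := ex_prod A B) (s := B) pr2.
Proof. by apply/extensional_points => x y /ex_sim_prod []. Qed.

Lemma extensional_pair (D A B : ex_ob P) (f : hom (ex_carrier D) (ex_carrier A))
    (g : hom (ex_carrier D) (ex_carrier B)) :
  extensional f -> extensional g -> extensional (s := ex_prod A B) ⟨f, g⟩.
Proof.
move=> /extensional_points Hf /extensional_points Hg; apply/extensional_points => x y H.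
by apply/ex_sim_prod; rewrite !pair_comp !pr1_pair !pr2_pair; split; [apply: Hf | apply: Hg].
Qed.

(** Arrows are classes, so pairing needs chosen representatives; [ex_pair_class_of] shows that the
    choice does not matter. *)
Definition ex_repr (A B : ex_ob P) (c : ex_hom A B) : hom (ex_carrier A) (ex_carrier B) :=
  proj1_sig (constructive_indefinite_description _ (ex_hom_repr c)).

Lemma ex_reprP (A B : ex_ob P) (c : ex_hom A B) :
  exists Hf : extensional (ex_repr c), c = ex_class_of Hf.
Proof. exact: (proj2_sig (constructive_indefinite_description _ (ex_hom_repr c))). Qed.

Definition ex_pair (D A B : ex_ob P) (c : ex_hom D A) (d : ex_hom D B) : ex_hom D (ex_prod A B) :=
  ex_class_of (extensional_pair (proj1_sig (constructive_indefinite_description _ (ex_reprP c)))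
    (proj1_sig (constructive_indefinite_description _ (ex_reprP d)))).

Lemma ex_pair_class_of (D A B : ex_ob P) (f : hom (ex_carrier D) (ex_carrier A))
    (g : hom (ex_carrier D) (ex_carrier B)) (Hf : extensional f) (Hg : extensional g) :
  ex_pair (ex_class_of Hf) (ex_class_of Hg) = ex_class_of (extensional_pair Hf Hg).
Proof.
rewrite /ex_pair; apply/ex_class_of_eq; apply/ex_sim_prod; rewrite !pr1_pair !pr2_pair.
have [Hf' Ef] := ex_reprP (ex_class_of Hf).
have [Hg' Eg] := ex_reprP (ex_class_of Hg).
by split; apply: ex_sim_sym; [move/ex_class_of_eq: Ef | move/ex_class_of_eq: Eg].
Qed.

Lemma extensional_bang (A : ex_ob P) :
  extensional (r := A) (s := discrete one) (bang (ex_carrier A)).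
Proof. by apply/extensional_points => x y _; apply/ex_sim_discrete; apply: bang_eq. Qed.

Definition ex_finprod : finprod (exact_completion P).
Proof.
refine (@FinProd (exact_completion P) (discrete one)
  (fun A => ex_class_of (extensional_bang A)) _ ex_prod
  (fun A B => ex_class_of (extensional_pr1 A B)) (fun A B => ex_class_of (extensional_pr2 A B))
  ex_pair _ _ _).
- move=> A c; have [f [Hf ->]] := ex_hom_repr c; apply/ex_class_of_eq.
  by rewrite (bang_uniq f); apply: ex_sim_refl.
- move=> D A B c d; have [f [Hf ->]] := ex_hom_repr c; have [g [Hg ->]] := ex_hom_repr d.
  rewrite ex_pair_class_of /= ex_comp_class_of; apply/ex_class_of_eq.
  by rewrite pr1_pair; apply: ex_sim_refl.
- move=> D A B c d; have [f [Hf ->]] := ex_hom_repr c; have [g [Hg ->]] := ex_hom_repr d.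
  rewrite ex_pair_class_of /= ex_comp_class_of; apply/ex_class_of_eq.
  by rewrite pr2_pair; apply: ex_sim_refl.
- move=> D A B c; have [f [Hf ->]] := ex_hom_repr c.
  rewrite /= !ex_comp_class_of ex_pair_class_of; apply/ex_class_of_eq.
  by rewrite pair_eta; apply: ex_sim_refl.
Defined.

Let Q := ex_finprod.

(** * Points and definable sets of the exact completion *)

Lemma comp_class_of (A B D : ex_ob P) (g : hom (ex_carrier B) (ex_carrier D))
    (f : hom (ex_carrier A) (ex_carrier B)) (Hg : extensional g) (Hf : extensional f) :
  @comp (exact_completion P) A B D (ex_class_of Hg) (ex_class_of Hf) =
  ex_class_of (extensional_comp Hg Hf).
Proof. exact: ex_comp_class_of. Qed.

(** The terminal object is [discrete one], so every point of the carrier is extensional. *)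
Definition pt (A : ex_ob P) (x : el P (ex_carrier A)) : el Q A :=
  ex_class_of (extensional_discrete x).

Lemma pt_surj (A : ex_ob P) (e : el Q A) : exists x, e = pt x.
Proof.
by have [f [Hf ->]] := ex_hom_repr e; exists f; apply/ex_class_of_eq; apply: ex_sim_refl.
Qed.

Lemma pt_eq (A : ex_ob P) (x y : el P (ex_carrier A)) : pt x = pt y <-> ex_sim x y.
Proof. exact: ex_class_of_eq. Qed.

Lemma class_of_pt (A B : ex_ob P) (f : hom (ex_carrier A) (ex_carrier B)) (Hf : extensional f)
    (x : el P (ex_carrier A)) :
  @comp (exact_completion P) _ A B (ex_class_of Hf) (pt x) = pt (f ∘ x).
Proof. by rewrite comp_class_of; apply/ex_class_of_eq; apply: ex_sim_refl. Qed.

Lemma pt_pair (A B : ex_ob P) (x : el P (ex_carrier A)) (y : el P (ex_carrier B)) :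
  @pair _ Q _ _ _ (pt x) (pt y) = @pt (ex_prod A B) ⟨x, y⟩.
Proof.
by rewrite [LHS]ex_pair_class_of; apply/ex_class_of_eq; apply: ex_sim_refl.
Qed.

Lemma pr1_pt (A B : ex_ob P) (z : el P (ex_carrier (ex_prod A B))) :
  @comp (exact_completion P) _ _ A (@pr1 _ Q A B) (pt z) = pt (pr1 ∘ z).
Proof. exact: class_of_pt. Qed.

Lemma pr2_pt (A B : ex_ob P) (z : el P (ex_carrier (ex_prod A B))) :
  @comp (exact_completion P) _ _ B (@pr2 _ Q A B) (pt z) = pt (pr2 ∘ z).
Proof. exact: class_of_pt. Qed.

Lemma ex_arrow_eq (A B : ex_ob P) (f g : hom (ex_carrier A) (ex_carrier B))
    (Hf : extensional f) (Hg : extensional g) :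
  ex_class_of Hf = ex_class_of Hg <->
  forall x : el P (ex_carrier A), pt (f ∘ x) = pt (g ∘ x).
Proof.
rewrite ex_class_of_eq ex_sim_points.
by split=> H x; apply/pt_eq.
Qed.

(** Forwards, the image of a representative is saturated under the relation of [A]. Backwards, an
    arrow into the carrier represents an arrow out of a discrete object. *)
Lemma definable_pt (A : ex_ob P) (U : el Q A -> Prop) :
  definable U <-> definable (fun x : el P (ex_carrier A) => U (pt x)).
Proof.
split=> [[R [r Hr]] | [R [r Hr]]].
- have [f [Hf Er]] := ex_hom_repr r; subst r.
  have H : definable (fun x : el P (ex_carrier A) =>
      exists a : el P (ex_carrier R), ⟨f ∘ a, x⟩ ∈[ex_rel A]) by definability.
  apply: definable_ext H => x; rewrite Hr; split.
  + move=> [a Ha]; exists (pt a); rewrite class_of_pt; exact/pt_eq.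
  + move=> [a]; have [a0 ->] := pt_surj a; rewrite class_of_pt => /pt_eq Ha.
    by exists a0.
- exists (discrete R), (ex_class_of (extensional_discrete r)) => e.
  have [x ->] := pt_surj e; split.
  + by move=> /Hr [a <-]; exists (@pt (discrete R) a); rewrite class_of_pt.
  + move=> [a]; have [a0 ->] := pt_surj a; rewrite class_of_pt => <-.
    by apply/Hr; exists a0.
Qed.

Lemma definable_rel_pt (A B : ex_ob P) (V : el Q A -> el Q B -> Prop) :
  definable_rel V <->
  definable_rel (fun (x : el P (ex_carrier A)) (y : el P (ex_carrier B)) => V (pt x) (pt y)).
Proof.
rewrite {1}/definable_rel definable_pt.
by split; apply: definable_ext => z; rewrite pr1_pt pr2_pt.
Qed.

(** * Pointwise properties of the exact completion *)

Lemma ex_separating : terminal_separating Q.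
Proof.
move=> A B c d; have [f [Hf ->]] := ex_hom_repr c; have [g [Hg ->]] := ex_hom_repr d => H.
by apply/ex_arrow_eq => x; have := H (pt x); rewrite !class_of_pt.
Qed.

Lemma ex_equality_definable : equality_definable Q.
Proof.
move=> A B c d; have [f [Hf ->]] := ex_hom_repr c; have [g [Hg ->]] := ex_hom_repr d.
apply/definable_pt.
have H : definable (fun x : el P (ex_carrier A) => ⟨f ∘ x, g ∘ x⟩ ∈[ex_rel B]) by definability.
by apply: definable_ext H => x; rewrite !class_of_pt pt_eq.
Qed.

(** Choice in [C] selects a value for each representative; uniqueness up to equivalence makes the
    selected arrow extensional. *)
Lemma ex_unique_choice : unique_choice Q.
Proof.
move=> A B V HV Huniq.
case: (relation_choice (V := fun x y => V (@pt A x) (@pt B y))).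
- exact/definable_rel_pt.
- move=> x; have [e [He _]] := Huniq (pt x); have [y Hy] := pt_surj e.
  by exists y; rewrite -Hy.
- move=> f Hf.
  have Hext : extensional f.
  { apply/extensional_points => x y /pt_eq Hxy; apply/pt_eq.
    have [e [_ He]] := Huniq (pt x).
    by rewrite -(He _ (Hf x)); apply: He; rewrite Hxy. }
  exists (ex_class_of Hext) => e; have [x ->] := pt_surj e.
  by rewrite class_of_pt.
Qed.

(** The quotient keeps the carrier and coarsens the relation; the identity of the carrier represents
    the quotient arrow. *)
Lemma ex_quotients : pointwise_quotients Q.
Proof.
move=> A V HV [Vrefl [Vsym Vtrans]].
have [R [r [Hr HrV]]] : exists (R : C) (r : hom R (ex_carrier A × ex_carrier A))
    (Hr : is_pseudo_equivalence_relation r),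
    forall x y : el P (ex_carrier A), ex_sim (s := ExOb Hr) x y <-> V (pt x) (pt y).
{ apply: ex_ob_of_equivalence; first exact/definable_rel_pt.
  by split=> //; split=> [x y | x y z]; [apply: Vsym | apply: Vtrans]. }
have Hid : extensional (r := A) (s := ExOb Hr) idn.
{ apply/extensional_points => x y /pt_eq Hxy; rewrite !comp_idl.
  by apply/HrV; rewrite Hxy. }
exists (ExOb Hr), (ex_class_of Hid); split.
- move=> e; have [x ->] := pt_surj e; exists (@pt A x); rewrite class_of_pt.
  by rewrite comp_idl.
- move=> e e'; have [x ->] := pt_surj e; have [y ->] := pt_surj e'.
  by rewrite !class_of_pt !comp_idl pt_eq.
Qed.

(** The identity of the carrier represents a cover by a discrete object. A surjection onto a
    discrete object has a representative that is surjective in [C], where it splits. *)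
Lemma ex_choice_covers (A : exact_completion P) :
  exists (X : exact_completion P) (f : hom X A), choice_object Q X /\ surjective Q f.
Proof.
exists (discrete (ex_carrier A)), (ex_class_of (extensional_discrete (A := A) idn)); split.
- move=> B c; have [q [Hq ->]] := ex_hom_repr c => Hsurj.
  have [t Ht] : exists t, q ∘ t = idn.
  { apply: Hchoice => y; have [e] := Hsurj (@pt (discrete (ex_carrier A)) y).
    have [x ->] := pt_surj e; rewrite class_of_pt => /pt_eq /ex_sim_discrete Hx.
    by exists x. }
  exists (ex_class_of (extensional_discrete t)).
  rewrite comp_class_of; apply/ex_class_of_eq; rewrite Ht; exact: ex_sim_refl.
- move=> e; have [x ->] := pt_surj e; exists (@pt (discrete (ex_carrier A)) x).
  by rewrite class_of_pt comp_idl.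
Qed.

Lemma ex_weak_nno : has_weak_nno P -> has_weak_nno Q.
Proof.
move=> [N [z [s Hrec]]].
exists (discrete N), (@pt (discrete N) z),
  (ex_class_of (extensional_discrete (A := discrete N) s)) => A e c.
have [x ->] := pt_surj e; have [f [Hf ->]] := ex_hom_repr c.
have [g [Hgz Hgs]] := Hrec _ x f.
exists (ex_class_of (extensional_discrete g)); split; first by rewrite class_of_pt Hgz.
rewrite !comp_class_of; apply/ex_class_of_eq; rewrite Hgs; exact: ex_sim_refl.
Qed.

Lemma ex_closed_for_pseudo_relations :
  closed_for_pseudo_relations P -> closed_for_pseudo_relations Q.
Proof.
move=> Hcl Y X I cg cf.
have [g [Hg ->]] := ex_hom_repr cg; have [f [Hf ->]] := ex_hom_repr cf.
(* [X'] and [Y'] turn the fibres of [f] and [g] up to equivalence into strict fibres in [C]. *)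
have [X' [xi Hxi]] : definable (fun w : el P (ex_carrier X × ex_carrier I) =>
    ⟨f ∘ (pr1 ∘ w), pr2 ∘ w⟩ ∈[ex_rel I]) by definability.
have [Y' [eta Heta]] : definable (fun w : el P (X' × ex_carrier Y) =>
    ⟨g ∘ (pr2 ∘ w), pr1 ∘ (xi ∘ (pr1 ∘ w))⟩ ∈[ex_rel X]) by definability.
have Hxi1 : forall a : el P X', pt (f ∘ (pr1 ∘ (xi ∘ a))) = pt (pr2 ∘ (xi ∘ a)).
{ by move=> a; apply/pt_eq; apply/(Hxi (xi ∘ a)); exists a. }
have Hxi2 : forall x i, pt (f ∘ x) = @pt I i -> exists a : el P X', xi ∘ a = ⟨x, i⟩.
{ by move=> x i /pt_eq H; apply/Hxi; rewrite pr1_pair pr2_pair. }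
have Heta1 : forall b : el P Y', pt (g ∘ (pr2 ∘ (eta ∘ b))) = pt (pr1 ∘ (xi ∘ (pr1 ∘ (eta ∘ b)))).
{ by move=> b; apply/pt_eq; apply/(Heta (eta ∘ b)); exists b. }
have Heta2 : forall a y, pt (g ∘ y) = pt (pr1 ∘ (xi ∘ a)) -> exists b : el P Y', eta ∘ b = ⟨a, y⟩.
{ by move=> a y /pt_eq H; apply/Heta; rewrite pr1_pair pr2_pair. }
have [F [R [phi [alpha [[Ha Hb] Hfull]]]]] := Hcl Y' X' (ex_carrier I) (pr1 ∘ eta) (pr2 ∘ xi).
have [al Eal] : exists al : hom R (F × ex_carrier X × ex_carrier Y),
    al = ⟨pr1 ∘ (pr1 ∘ alpha), pr1 ∘ (xi ∘ (pr2 ∘ (pr1 ∘ alpha))), pr2 ∘ (eta ∘ (pr2 ∘ alpha))⟩.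
{ by eexists. }
have Hal : forall (c : el P F) (x : el P (ex_carrier X)) (y : el P (ex_carrier Y)),
  @mem _ Q _ _ (ex_class_of (extensional_discrete
    (A := ex_prod (ex_prod (discrete F) X) Y) al))
    (@pair _ Q _ _ _ (@pair _ Q _ _ _ (@pt (discrete F) c) (@pt X x)) (@pt Y y)) <->
  exists a b, ⟨c, a, b⟩ ∈[alpha] /\ @pt X (pr1 ∘ (xi ∘ a)) = pt x /\ @pt Y (pr2 ∘ (eta ∘ b)) = pt y.
{ move=> c x y; rewrite !pt_pair; split.
  - move=> [e]; have [k ->] := pt_surj e; rewrite class_of_pt Eal.
    move=> /pt_eq /ex_sim_prod [/ex_sim_prod []].
    catsimp.
    move=> /ex_sim_discrete Hc /pt_eq Hx /pt_eq Hy.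
    exists (pr2 ∘ (pr1 ∘ (alpha ∘ k))), (pr2 ∘ (alpha ∘ k)); split=> //.
    by exists k; rewrite -Hc !pair_eta.
  - move=> [a [b [[k Hk] [/pt_eq Hx /pt_eq Hy]]]]; exists (@pt (discrete R) k).
    rewrite class_of_pt Eal; apply/pt_eq; apply/ex_sim_prod; split; first apply/ex_sim_prod; first split.
    + apply/ex_sim_discrete; by catsimp; rewrite Hk; catsimp.
    + by catsimp; rewrite Hk; catsimp.
    + by catsimp; rewrite Hk; catsimp. }
exists (discrete F), (discrete R), (ex_class_of (extensional_discrete (A := I) phi)),
  (ex_class_of (extensional_discrete (A := ex_prod (ex_prod (discrete F) X) Y) al)).
split; first split.
- move=> e1 e2 e3; have [c ->] := pt_surj e1; have [x ->] := pt_surj e2; have [y ->] := pt_surj e3.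
  move=> /Hal [a [b [/Ha <- [<- <-]]]].
  by rewrite class_of_pt Heta1 -comp_assoc.
- move=> e1 e2; have [c ->] := pt_surj e1; have [x ->] := pt_surj e2.
  rewrite !class_of_pt; split.
  (* Pairing [x] with [phi ∘ c] itself turns equivalence of indices into equality. *)
  + move=> /Hxi2 [a Hxa].
    have /Hb [b Hab] : (pr2 ∘ xi) ∘ a = phi ∘ c by rewrite -comp_assoc Hxa pr2_pair.
    exists (@pt Y (pr2 ∘ (eta ∘ b))); apply/Hal; exists a, b; split=> //.
    by rewrite Hxa pr1_pair.
  + move=> [e]; have [y ->] := pt_surj e => /Hal [a [b [Hab [Hx _]]]].
    have Hi : (pr2 ∘ xi) ∘ a = phi ∘ c by apply/Hb; exists b.
    by rewrite -Hi -comp_assoc -Hxi1 -(class_of_pt Hf) -Hx class_of_pt.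
- move=> R' r e [Hra Hrb]; have [i Ei] := pt_surj e; subst e.
  pose r0 (x : el P (ex_carrier X)) (y : el P (ex_carrier Y)) :=
    @mem _ Q _ _ r (@pair _ Q _ _ _ (@pt X x) (@pt Y y)).
  have Hr0 : definable_rel r0.
  { apply/(definable_rel_pt (fun x y => @mem _ Q _ _ r (@pair _ Q _ _ _ x y))).
    by have Heq' := ex_equality_definable; definability. }
  (* The relation [r] is pulled back to [X'] and [Y'], with the index fixed to the representative
     [i], which gives a pseudo-relation in [C]. *)
  have [R0 [s Hs]] : definable (fun w : el P (X' × Y') => pr1 ∘ (eta ∘ (pr2 ∘ w)) = pr1 ∘ w /\
    pr2 ∘ (xi ∘ (pr1 ∘ w)) = i /\
    r0 (pr1 ∘ (xi ∘ (pr1 ∘ w))) (pr2 ∘ (eta ∘ (pr2 ∘ w)))) by definability.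
  have Hs' : forall a b, ⟨a, b⟩ ∈[s] <-> pr1 ∘ (eta ∘ b) = a /\ pr2 ∘ (xi ∘ a) = i /\
      r0 (pr1 ∘ (xi ∘ a)) (pr2 ∘ (eta ∘ b)).
  { by move=> a b; rewrite -Hs pr1_pair pr2_pair. }
  case: (Hfull R0 s i).
  + split; first by move=> a b /Hs' []; rewrite comp_assoc.
    move=> a; rewrite -comp_assoc; split; last by move=> [b /Hs' [_ []]].
    move=> Hai.
    have /Hrb [e He] : @comp (exact_completion P) _ _ I (ex_class_of Hf)
        (@pt X (pr1 ∘ (xi ∘ a))) = pt i by rewrite class_of_pt Hxi1 Hai.
    have [y Ey] := pt_surj e; subst e.
    have := Hra _ _ He; rewrite class_of_pt => /Heta2 [b Hab].
    by exists b; apply/Hs'; rewrite Hab pr1_pair pr2_pair.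
  + move=> c [Hc Hcs]; exists (@pt (discrete F) c); split; first by rewrite class_of_pt Hc.
    move=> e1 e2; have [x ->] := pt_surj e1; have [y ->] := pt_surj e2.
    by move=> /Hal [a [b [/Hcs /Hs' [_ [_ H]] [<- <-]]]].
Qed.

(** * Finite sums *)

Lemma zero_no_points (S : finsum C) (Hnondeg : terminal_nondegenerate P)
    (Hstrict : initial_strict S) : el P zero -> False.
Proof.
move=> x; apply: (Hnondeg zero); last by exists x; apply: Hstrict.
by move=> X; exists (absurd X); split=> // f _; rewrite (absurd_uniq f).
Qed.

(** A point common to both summands would factor through [zero], which strictness would then make
    isomorphic to [one]. *)
Lemma finsum_pointwise_sums (S : finsum C) (Hnondeg : terminal_nondegenerate P)
    (Hindec : terminal_indecomposable P) (Hdisj : sums_disjoint S) (Hstrict : initial_strict S) :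
  pointwise_sums P.
Proof.
split.
- exists zero; split; last exact: zero_no_points.
  by move=> X; exists (absurd X); split=> // f _; rewrite (absurd_uniq f).
- move=> X Y; have [Hl [Hr [_ Hpb]]] := Hdisj X Y.
  have Hcop : is_coproduct (inl : hom X (X ⊕ Y)) (inr : hom Y (X ⊕ Y)).
  { move=> Z f g; exists (copair f g); split; first by rewrite copair_inl copair_inr.
    by move=> h [<- <-]; rewrite -copair_uniq. }
  exists (X ⊕ Y), inl, inr; split=> //; split; last split; last split.
  + by move=> x x'; apply: Hl.
  + by move=> y y'; apply: Hr.
  + by move=> x y Hxy; have [o _] := Hpb one x y Hxy; apply: zero_no_points o.
  + exact: Hindec Hcop.
Qed.

(** On the sum [T] of the carriers, points are related when they come from the same summand and are
    related there; copairs of representatives respect this. *)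
Lemma ex_pointwise_sums : pointwise_sums P -> pointwise_sums Q.
Proof.
move=> Hs; split.
- have [[O [HO HO']] _] := Hs; exists (discrete O); split.
  + move=> A; have [f _] := HO (ex_carrier A).
    exists (ex_class_of (extensional_discrete f)); split=> // c _.
    have [g [Hg ->]] := ex_hom_repr c; apply/ex_arrow_eq => x; case: (HO' x).
  + by move=> e; have [x _] := pt_surj e; apply: HO' x.
- move=> A B.
  have [T [i [j [Hij [Hi [Hj [Hd HT]]]]]]] := proj2 Hs (ex_carrier A) (ex_carrier B).
  pose V (z w : el P T) :=
    (exists x x' : el P (ex_carrier A), (z = i ∘ x /\ w = i ∘ x') /\ ⟨x, x'⟩ ∈[ex_rel A]) \/
    (exists y y' : el P (ex_carrier B), (z = j ∘ y /\ w = j ∘ y') /\ ⟨y, y'⟩ ∈[ex_rel B]).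
  have Vi x x' : V (i ∘ x) (i ∘ x') <-> ex_sim (s := A) x x'.
  { split; last by left; exists x, x'.
    case=> [[x1 [x2 [[/Hi -> /Hi ->] H]]] // | [y [y' [[H _] _]]]].
    by case: (Hd _ _ H). }
  have Vj y y' : V (j ∘ y) (j ∘ y') <-> ex_sim (s := B) y y'.
  { split; last by right; exists y, y'.
    case=> [[x [x' [[H _] _]]] | [y1 [y2 [[/Hj -> /Hj ->] H]]] //].
    by case: (Hd _ _ (eq_sym H)). }
  have Vij x y : ~ V (i ∘ x) (j ∘ y).
  { case=> [[x1 [x2 [[_ H] _]]] | [y1 [y2 [[H _] _]]]]; last exact: Hd H.
    exact: Hd (eq_sym H). }
  have Vji y x : ~ V (j ∘ y) (i ∘ x).
  { case=> [[x1 [x2 [[H _] _]]] | [y1 [y2 [[_ H] _]]]]; last exact: Hd H.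
    exact: Hd (eq_sym H). }
  have [R [r [Hr HrV]]] : exists (R : C) (r : hom R (T × T))
      (Hr : is_pseudo_equivalence_relation r),
      forall z w : el P T, ex_sim (s := ExOb Hr) z w <-> V z w.
  { apply: ex_ob_of_equivalence; first by rewrite /V; definability.
    split; last split.
    - by move=> z; case: (HT z) => [[x <-] | [y <-]]; [apply/Vi | apply/Vj]; apply: ex_sim_refl.
    - move=> z w [[x [x' [[-> ->] H]]] | [y [y' [[-> ->] H]]]]; [apply/Vi | apply/Vj];
        exact: ex_sim_sym H.
    - move=> z w v [[x [x' [[-> ->] H]]] | [y [y' [[-> ->] H]]]]; case: (HT v) => [[x2 <-] | [y2 <-]].
      + by move=> /Vi H'; apply/Vi; apply: ex_sim_trans H H'.
      + by move=> H'; case: (Vij _ _ H').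
      + by move=> H'; case: (Vji _ _ H').
      + by move=> /Vj H'; apply/Vj; apply: ex_sim_trans H H'. }
  have Hei : extensional (r := A) (s := ExOb Hr) i.
  { by apply/extensional_points => x x' H; apply/HrV; apply/Vi. }
  have Hej : extensional (r := B) (s := ExOb Hr) j.
  { by apply/extensional_points => x x' H; apply/HrV; apply/Vj. }
  exists (ExOb Hr), (ex_class_of Hei), (ex_class_of Hej); split; last split; last split; last split.
  + move=> D c d; have [f [Hf ->]] := ex_hom_repr c; have [g [Hg ->]] := ex_hom_repr d.
    have [h [[Hhi Hhj] _]] := Hij _ f g.
    have Hh : extensional (r := ExOb Hr) (s := D) h.
    { apply/extensional_points => z w /HrV [[x [x' [[-> ->] H]]] | [y [y' [[-> ->] H]]]];
        rewrite !comp_assoc ?Hhi ?Hhj.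
      - exact: (proj1 (extensional_points f) Hf).
      - exact: (proj1 (extensional_points g) Hg). }
    exists (ex_class_of Hh); split.
    * by split; rewrite comp_class_of; apply/ex_class_of_eq; rewrite ?Hhi ?Hhj; apply: ex_sim_refl.
    * move=> k; have [k0 [Hk ->]] := ex_hom_repr k; rewrite !comp_class_of => [[Ei Ej]].
      apply/ex_arrow_eq => z; case: (HT z) => [[x <-] | [y <-]].
      -- by rewrite !comp_assoc Hhi; move/ex_arrow_eq: Ei => ->.
      -- by rewrite !comp_assoc Hhj; move/ex_arrow_eq: Ej => ->.
  + move=> e e'; have [x ->] := pt_surj e; have [x' ->] := pt_surj e'.
    by rewrite !class_of_pt => /pt_eq /HrV /Vi H; apply/pt_eq.
  + move=> e e'; have [x ->] := pt_surj e; have [x' ->] := pt_surj e'.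
    by rewrite !class_of_pt => /pt_eq /HrV /Vj H; apply/pt_eq.
  + move=> e e'; have [x ->] := pt_surj e; have [y ->] := pt_surj e'.
    by rewrite !class_of_pt => /pt_eq /HrV /Vij.
  + move=> e; have [z ->] := pt_surj e; case: (HT z) => [[x <-] | [y <-]].
    * by left; exists (@pt A x); rewrite class_of_pt.
    * by right; exists (@pt B y); rewrite class_of_pt.
Qed.

End ExactCompletionPoints.

Unset Implicit Arguments.

Theorem theorem5p9 (C : category) (P : finprod C) (S : finsum C)
  (HE : has_weak_equalisers C)
  (Hchoice : forall X : C, choice_object P X)
  (Hnondeg : terminal_nondegenerate P)
  (Hindec : terminal_indecomposable P)
  (Hlext : weakly_lextensive P S)
  (Hclosed : closed_for_pseudo_relations P)
  (Hnno : has_weak_nno P) :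
  is_model_of_CETCS (exact_completion P).
Proof.
have [[Hdisj Hstrict] _] := Hlext.
exists (ex_finprod HE Hchoice); apply: CETCS_of_pointwise.
- exact: ex_separating.
- exact: ex_equality_definable.
- exact: ex_unique_choice.
- exact: ex_quotients.
- exact/ex_pointwise_sums/finsum_pointwise_sums.
- exact: ex_closed_for_pseudo_relations.
- exact: ex_choice_covers.
- exact: ex_weak_nno.
Qed.
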